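(* Let $\nu>0$, $f\in L^\infty(\mathbb T)$, and let $u$ be the solution of $$\partial_tu+\Pi_N(uu_x)=\nu^2u_{xx},\quad(t,x)\in(0,\infty)\times\mathbb T,\qquad u|_{t=0}=u^0=\Pi_Nf.$$ Then for all $N\ge2$, $$\sup_{t\ge0}\|u(t)\|_\infty\le\|u^0\|_\infty+\alpha\cdot N^{-c},$$ where $c>0$ is an absolute constant and $\alpha>0$ depends only on $(\|f\|_\infty,\nu)$.
   Context: $\mathbb T=\mathbb R/\mathbb Z$; functions are real-valued; $\Pi_Nf(x)=\sum_{|k|\le N}\widehat f(k)e^{2\pi ikx}$ with $\widehat f(k)=\int_0^1f(x)e^{-2\pi ikx}dx$; $\|\cdot\|_\infty$ is the $L^\infty(\mathbb T)$ norm. *)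

(* Defs.v *)
From HB Require Import structures.
From mathcomp Require Import all_boot all_order all_algebra.
From mathcomp Require Import complex zify ring lra.
From mathcomp Require Import all_classical all_reals all_analysis.
Set Implicit Arguments.
Unset Strict Implicit.
Unset Printing Implicit Defensive.
Import Order.TTheory GRing.Theory Num.Theory.
Import numFieldNormedType.Exports.
Local Open Scope classical_set_scope.
Local Open Scope ring_scope.
Local Open Scope complex_scope.

(* Functions on T = R/Z are represented by 1-periodic functions on R, and L^p
   spaces on T are taken with respect to Lebesgue measure on [0, 1]. *)
Definition torus_measure (R : realType) : {measure set (measurableTypeR R) -> \bar R} :=
  mrestr (@lebesgue_measure R) (measurable_itv `[0%R, 1%R]).

Definition Linfty_norm (R : realType) (g : R -> R) : \bar R :=
  ('N[torus_measure R]_+oo [EFin \o g])%E.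

(* Only Borel representatives of L^oo classes are considered: the library's
   measurable subsets of R are the Borel sets. *)
Definition Linfty_torus (R : realType) (g : R -> R) : Prop :=
  periodic g 1 /\ g \in Lfun (torus_measure R) +oo%E.

Section fourier.
Variable R : realType.

Definition expi (a : R) : R[i] := cos a +i* sin a.

Definition complex_integral (g : R -> R[i]) : R[i] :=
  (\int[@lebesgue_measure R]_(x in `[0%R, 1%R]) complex.Re (g x))
  +i* (\int[@lebesgue_measure R]_(x in `[0%R, 1%R]) complex.Im (g x)).

Definition fourier_coef (f : R -> R) (k : int) : R[i] :=
  complex_integral (fun x => (f x)%:C * expi (- (2 * pi * k%:~R * x))).

(* The index j < 2N+1 stands for the frequency k = j - N, so |k| <= N. *)
Definition fourier_sum (N : nat) (f : R -> R) (x : R) : R[i] :=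
  \sum_(j < (2 * N).+1)
    fourier_coef f (j%:Z - N%:Z) * expi (2 * pi * (j%:Z - N%:Z)%:~R * x).

(* Taking real parts loses nothing: see fourier_projE. *)
Definition fourier_proj (N : nat) (f : R -> R) (x : R) : R :=
  complex.Re (fourier_sum N f x).

Lemma RintegralN_itv (g : R -> R) :
  (\int[@lebesgue_measure R]_(x in `[0%R, 1%R]) (- g x) =
   - \int[@lebesgue_measure R]_(x in `[0%R, 1%R]) g x)%R.
Proof.
rewrite /Rintegral; under eq_integral do rewrite EFinN.
rewrite [in LHS]integralE [in RHS]integralE.
rewrite (_ : (fun x => - (g x)%:E)%E = (\- (EFin \o g))%E)//.
rewrite funeposN funenegN.
set a := integral _ _ _; set b := integral _ _ _.
by case: a => [a||]; case: b => [b||] //=; rewrite ?oppr0// opprB.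
Qed.

Lemma fourier_coefN f k : fourier_coef f (- k) = (fourier_coef f k)^*.
Proof.
rewrite /fourier_coef /complex_integral /expi; apply/eqP.
rewrite eq_complex/= -RintegralN_itv; apply/andP; split; apply/eqP.
  congr (Rintegral _ _ _); apply/funext => x.
  by rewrite rmorphN /= mulrN mulNr !cosN !mul0r.
congr (Rintegral _ _ _); apply/funext => x.
by rewrite rmorphN /= mulrN mulNr !sinN !mul0r !addr0 mulrN.
Qed.

Lemma fourier_projE N f x : (fourier_proj N f x)%:C = fourier_sum N f x.
Proof.
suff: (fourier_sum N f x)^* = fourier_sum N f x.
  rewrite /fourier_proj; case: (fourier_sum N f x) => a b /= [bb].
  by congr (_ +i* _); lra.
rewrite {1}/fourier_sum rmorph_sum (reindex_inj rev_ord_inj).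
apply: eq_bigr => j _.
have -> : (rev_ord j)%:Z - N%:Z = - (j%:Z - N%:Z) :> int.
  by have := ltn_ord j; rewrite /=; lia.
rewrite fourier_coefN mulrNz mulrN mulNr /expi cosN sinN.
by case: (fourier_coef f _) => a b; congr (_ +i* _); rewrite /=; ring.
Qed.

End fourier.

Notation "\Pi_( N ) f" := (fourier_proj N f)
  (at level 10, N at level 200, f at level 8, format "\Pi_( N )  f").

(* Classical solutions in C([0,oo) x T) and C^{1,2}((0,oo) x T); the values of
   u at negative times are irrelevant. *)
Record galerkin_solution (R : realType) (nu : R) (N : nat) (u0 : R -> R)
    (u : R -> R -> R) : Prop := {
  sol_periodic : forall t : R, 0 <= t -> periodic (u t) 1 ;
  sol_continuous :
    {within [set p : R * R | 0 <= p.1], continuous (fun p => u p.1 p.2)} ;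
  sol_derivable_t : forall t x : R, 0 < t -> derivable (fun s => u s x) t 1 ;
  sol_derivable_x : forall t x : R, 0 < t -> derivable (u t) x 1 ;
  sol_derivable_xx : forall t x : R, 0 < t -> derivable (derive1 (u t)) x 1 ;
  sol_continuous_t :
    {within [set p : R * R | 0 < p.1],
      continuous (fun p => derive1 (fun s => u s p.2) p.1)} ;
  sol_continuous_x :
    {within [set p : R * R | 0 < p.1],
      continuous (fun p => derive1 (u p.1) p.2)} ;
  sol_continuous_xx :
    {within [set p : R * R | 0 < p.1],
      continuous (fun p => derive1 (derive1 (u p.1)) p.2)} ;
  sol_equation : forall t x : R, 0 < t ->
    derive1 (fun s => u s x) t
    + (\Pi_(N) (fun y => u t y * derive1 (u t) y)) x
    = nu ^+ 2 * derive1 (derive1 (u t)) x ;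
  sol_initial : u 0 = u0 }.

(* Main.v *)
Require Import Defs.
From mathcomp Require Import all_boot all_order all_algebra.
From mathcomp Require Import complex zify ring lra.
From mathcomp Require Import all_classical all_reals all_analysis.
From mathcomp Require Import ess_sup_inf measurable_realfun.
Import Order.TTheory GRing.Theory Num.Theory.
Import numFieldNormedType.Exports.
Set Implicit Arguments.
Unset Strict Implicit.
Unset Printing Implicit Defensive.
Local Open Scope classical_set_scope.
Local Open Scope ring_scope.

(* The solution stays a trigonometric polynomial of degree N, and solves
   u_t + u u_x = nu^2 u_xx + r with r = u u_x - Pi_N (u u_x).  At a point where
   |u(t)| is maximal the transport and diffusion terms have a sign, so |u|_oo
   grows at most at the rate |r|_oo.  Since r only has frequencies in (N, 2N],
   |r|_oo <= C N^(-1/2) |(u u_x)_x|_2 <= C N^(-1/2) |u|_oo |u_xx|_2, the last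
   step because u_x^4 = (u u_x^3)_x - 3 u u_x^2 u_xx.  Hence
     |u(t)|_oo <= |u(0)|_oo exp (C N^(-1/2) \int |u_xx|_2),
   and the integral is O(ln N): energy inequalities bound the integral of
   w |u_xx|_2^2 for the weight w(t) = (t + N^-2)(t + 1), while 1/w has integral
   O(ln N).  Finally |u(0)|_oo = |Pi_N f|_oo <= C N^(1/3) |f|_oo, and
   1/3 < 1/2.  Integrals in time are avoided by putting antiderivatives (the
   Lyapunov function and a logarithm) into the barrier. *)

(** * The mean over a period *)

(** Three difficulties shape the estimates. The datum is bounded only in the sup norm, so smoothing
    makes [t |u_xx|_2^2] integrable and Cauchy-Schwarz meets the divergent integral of [1 / t];
    shifting [t] by [N^-2], the diffusive time of frequency [N], turns the divergence into [ln N].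
    For large [t] the weight has to grow quadratically, which is affordable because energies without
    the mean decay exponentially. Finally the bound on [u] is multiplicative while the available
    bound on the datum grows with [N], so the exponent must be small enough to beat that growth.

    The datum bound comes from cutting the Dirichlet kernel at distance [1 / n] from the diagonal:
    Cauchy-Schwarz near it costs [(N / n)^(1/2)], the rest costs [n], and these balance at
    [n = N^(1/3)]. With [x = N^(1/12)] the datum is [O(x^4)], the projection error contributes
    [x^-6] and the logarithm is [O(x)]; the product is [O(x^-1)], whence the exponent [1/12]. *)

Section mean_value.
Variable R : realType.
Local Notation mu := (@lebesgue_measure R).
Implicit Types f g F : R -> R.

Definition mean g : R := \int[mu]_(x in `[0%R, 1%R]) g x.

Definition integrable01 g := mu.-integrable `[0%R, 1%R] (EFin \o g).

Lemma continuous_integrable01 g : continuous g -> integrable01 g.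
Proof.
move=> cg; apply: continuous_compact_integrable; first exact: segment_compact.
exact: continuous_subspaceT.
Qed.

Lemma eq_mean f g : f =1 g -> mean f = mean g.
Proof. by move=> fg; apply: eq_Rintegral => x _. Qed.

Lemma meanD f g : integrable01 f -> integrable01 g ->
  mean (fun x => f x + g x) = mean f + mean g.
Proof. by move=> *; exact: RintegralD. Qed.

Lemma integrable01D f g : integrable01 f -> integrable01 g ->
  integrable01 (fun x => f x + g x).
Proof. by move=> fi gi; exact: (integrableD (mu := mu) (measurable_itv _) fi gi). Qed.

Lemma meanZ (a : R) f : integrable01 f -> mean (fun x => a * f x) = a * mean f.
Proof. by move=> fi; exact: RintegralZl. Qed.

Lemma integrable01Z (a : R) f : integrable01 f -> integrable01 (fun x => a * f x).
Proof. by move=> fi; exact: (integrableZl (mu := mu) (measurable_itv _) a fi). Qed.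

Lemma meanN f : mean (fun x => - f x) = - mean f.
Proof. exact: RintegralN_itv. Qed.

Lemma mean_cst (a : R) : mean (fun=> a) = a.
Proof.
by rewrite /mean Rintegral_cst//= lebesgue_measure_itv/= lte01 oppr0 adde0 mulr1.
Qed.

Lemma integrable01_sum (I : Type) (r : seq I) (P : pred I) (h : I -> R -> R) :
  (forall i, P i -> integrable01 (h i)) ->
  integrable01 (fun x => \sum_(i <- r | P i) h i x).
Proof.
move=> hi; elim: r => [|i r IH].
  apply: continuous_integrable01; rewrite (_ : (fun _ => _) = cst 0).
    exact: cst_continuous.
  by apply/funext => x; rewrite big_nil.
have [Pi|nPi] := boolP (P i).
  rewrite (_ : (fun _ => _) = fun x => h i x + \sum_(i <- r | P i) h i x).
    by apply: integrable01D => //; exact: hi.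
  by apply/funext => x; rewrite big_cons Pi.
rewrite (_ : (fun _ => _) = fun x => \sum_(i <- r | P i) h i x)//.
by apply/funext => x; rewrite big_cons (negbTE nPi).
Qed.

Lemma mean_sum (I : Type) (r : seq I) (P : pred I) (h : I -> R -> R) :
  (forall i, P i -> integrable01 (h i)) ->
  mean (fun x => \sum_(i <- r | P i) h i x) = \sum_(i <- r | P i) mean (h i).
Proof.
move=> hi; elim: r => [|i r IH].
  rewrite big_nil -[RHS](mean_cst 0); apply: eq_mean => x.
  by rewrite big_nil.
rewrite big_cons -IH; have [Pi|nPi] := boolP (P i).
  rewrite -meanD; [|exact: hi|exact: integrable01_sum].
  by apply: eq_mean => x; rewrite big_cons Pi.
by apply: eq_mean => x; rewrite big_cons (negbTE nPi).
Qed.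

Lemma le_mean f g : integrable01 f -> integrable01 g ->
  (forall x, f x <= g x) -> mean f <= mean g.
Proof. by move=> fi gi fg; exact: le_Rintegral. Qed.

Lemma is_derive_continuous F f : (forall x : R, is_derive x 1 F (f x)) -> continuous F.
Proof.
by move=> dF x; apply: differentiable_continuous; apply/derivable1_diffP; exact: ex_derive.
Qed.

Lemma mean_derive F f : (forall x : R, is_derive x 1 F (f x)) -> continuous f ->
  mean f = F 1 - F 0.
Proof.
move=> dF cf; have cF := is_derive_continuous dF.
rewrite /mean /Rintegral (@continuous_FTC2 _ f F)//.
- exact: continuous_subspaceT.
- split=> [x _|/=|]; first exact: ex_derive.
    by apply: cvg_at_right_filter; exact: cF.
  by apply: cvg_at_left_filter; exact: cF.
- by move=> x _; rewrite derive1E; exact: derive_val.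
Qed.

(** Integration by parts in the form used below: applied to a periodic product, it moves a
    derivative without boundary terms. *)
Lemma mean_derive_periodic F f : (forall x : R, is_derive x 1 F (f x)) ->
  continuous f -> periodic F 1 -> mean f = 0.
Proof.
by move=> dF cf pF; rewrite (mean_derive dF cf) -[X in F X]add0r pF subrr.
Qed.

End mean_value.

(** * Trigonometric polynomials *)

Section trig.
Variable R : realType.
Implicit Types (f g F : R -> R) (a b : nat -> R) (k n : nat).

Definition freq k : R := 2 * pi * k%:R.
Definition cosk k (x : R) : R := cos (freq k * x).
Definition sink k (x : R) : R := sin (freq k * x).

Lemma is_derive_cosM (w x : R) :
  is_derive x 1 (fun y => cos (w * y)) (- w * sin (w * x)).
Proof.
have dw : is_derive x 1 (fun y => w * y) w.
  by rewrite -[X in is_derive _ _ _ X](mulr1 w); exact: is_deriveZ.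
have := is_derive1_comp (is_derive_cos (w * x)) dw.
by rewrite mulNr (mulrC (sin _)) -mulNr.
Qed.

Lemma is_derive_sinM (w x : R) :
  is_derive x 1 (fun y => sin (w * y)) (w * cos (w * x)).
Proof.
have dw : is_derive x 1 (fun y => w * y) w.
  by rewrite -[X in is_derive _ _ _ X](mulr1 w); exact: is_deriveZ.
have := is_derive1_comp (is_derive_sin (w * x)) dw.
by rewrite (mulrC (cos _)).
Qed.

Lemma is_derive_cosk k (x : R) : is_derive x 1 (cosk k) (- freq k * sink k x).
Proof. exact: is_derive_cosM. Qed.

Lemma is_derive_sink k (x : R) : is_derive x 1 (sink k) (freq k * cosk k x).
Proof. exact: is_derive_sinM. Qed.
Lemma continuous_cosk k : continuous (cosk k).
Proof. exact: is_derive_continuous (is_derive_cosk k). Qed.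

Lemma continuous_sink k : continuous (sink k).
Proof. exact: is_derive_continuous (is_derive_sink k). Qed.

Lemma freq0 : freq 0 = 0. Proof. by rewrite /freq mulr0. Qed.

Lemma freq_gt0 k : (0 < k)%N -> 0 < freq k.
Proof. by move=> k0; rewrite !mulr_gt0 ?pi_gt0// ltr0n. Qed.

Lemma freq_ge0 k : 0 <= freq k.
Proof. by rewrite !mulr_ge0 ?pi_ge0. Qed.

Lemma freqD k l : freq (k + l) = freq k + freq l.
Proof. by rewrite /freq natrD mulrDr. Qed.

Lemma freqB k l : (l <= k)%N -> freq (k - l) = freq k - freq l.
Proof. by move=> lk; rewrite /freq natrB// mulrBr. Qed.

Lemma cosk0 x : cosk 0 x = 1.
Proof. by rewrite /cosk freq0 mul0r cos0. Qed.

Lemma sink0 x : sink 0 x = 0.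
Proof. by rewrite /sink freq0 mul0r sin0. Qed.

Lemma cosk_periodic k : periodic (cosk k) 1.
Proof.
move=> x; rewrite /cosk mulrDr mulr1 {2}/freq.
rewrite (_ : 2 * pi * k%:R = (pi *+ 2) *+ k); last by rewrite mulr_natr mulr_natl.
exact: periodicn (@cosD2pi R) k _.
Qed.

Lemma sink_periodic k : periodic (sink k) 1.
Proof.
move=> x; rewrite /sink mulrDr mulr1 {2}/freq.
rewrite (_ : 2 * pi * k%:R = (pi *+ 2) *+ k); last by rewrite mulr_natr mulr_natl.
exact: periodicn (@sinD2pi R) k _.
Qed.

Lemma mean_cosk k : mean (cosk k) = (k == 0%N)%:R.
Proof.
have [->|k0] := eqVneq k 0%N.
  by rewrite (eq_mean (g := fun=> 1)) ?mean_cst// => x; rewrite cosk0.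
have fk : freq k != 0 by rewrite gt_eqF// freq_gt0// lt0n.
apply: (@mulfI _ (freq k)) => //; rewrite mulr0 -meanZ; last first.
  exact/continuous_integrable01/continuous_cosk.
apply: mean_derive_periodic (is_derive_sink k) _ (sink_periodic k).
by move=> x; apply: cvgM; [exact: cvg_cst|exact: continuous_cosk].
Qed.

Lemma mean_sink k : mean (sink k) = 0.
Proof.
have [->|k0] := eqVneq k 0%N.
  by rewrite (eq_mean (g := fun=> 0)) ?mean_cst// => x; rewrite sink0.
have fk : - freq k != 0 by rewrite oppr_eq0 gt_eqF// freq_gt0// lt0n.
apply: (@mulfI _ (- freq k)) => //; rewrite mulr0 -meanZ; last first.
  exact/continuous_integrable01/continuous_sink.
apply: mean_derive_periodic (is_derive_cosk k) _ (cosk_periodic k).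
by move=> x; apply: cvgM; [exact: cvg_cst|exact: continuous_sink].
Qed.

(** The condition [l <= k] keeps the natural subtraction [k - l] exact; the other order is recovered
    by symmetry where needed. *)
Lemma coskM k l x : (l <= k)%N ->
  cosk k x * cosk l x = 2^-1 * cosk (k + l) x + 2^-1 * cosk (k - l) x.
Proof.
by move=> lk; rewrite /cosk freqD freqB// mulrDl mulrBl cosB cosD; lra.
Qed.

Lemma sinkM k l x : (l <= k)%N ->
  sink k x * sink l x = - 2^-1 * cosk (k + l) x + 2^-1 * cosk (k - l) x.
Proof.
by move=> lk; rewrite /cosk /sink freqD freqB// mulrDl mulrBl cosB cosD; lra.
Qed.

Lemma sink_coskM k l x : (l <= k)%N ->
  sink k x * cosk l x = 2^-1 * sink (k + l) x + 2^-1 * sink (k - l) x.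
Proof.
by move=> lk; rewrite /cosk /sink freqD freqB// mulrDl mulrBl sinB sinD; lra.
Qed.

Lemma cosk_sinkM k l x : (l <= k)%N ->
  cosk k x * sink l x = 2^-1 * sink (k + l) x + - 2^-1 * sink (k - l) x.
Proof.
by move=> lk; rewrite /cosk /sink freqD freqB// mulrDl mulrBl sinB sinD; lra.
Qed.

Lemma mean_coskD (s t : R) k l :
  mean (fun x => s * cosk k x + t * cosk l x) =
  s * (k == 0%N)%:R + t * (l == 0%N)%:R.
Proof.
have ic j : integrable01 (cosk j) by exact/continuous_integrable01/continuous_cosk.
by rewrite meanD ?meanZ ?mean_cosk//; exact: integrable01Z.
Qed.

Lemma mean_sinkD (s t : R) k l :
  mean (fun x => s * sink k x + t * sink l x) = 0.
Proof.
have ic j : integrable01 (sink j) by exact/continuous_integrable01/continuous_sink.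
by rewrite meanD ?meanZ ?mean_sink ?mulr0 ?addr0//; exact: integrable01Z.
Qed.

(* The normalisation making [\Pi_N f] the trigonometric polynomial with
   coefficients [coefc f] and [coefs f]. *)
Definition weight k : R := if k == 0%N then 1 else 2.

Lemma weight_gt0 k : 0 < weight k. Proof. by rewrite /weight; case: ifP. Qed.

Lemma mean_coskM k l :
  mean (fun x => cosk k x * cosk l x) = (k == l)%:R / weight k.
Proof.
wlog lk : k l / (l <= k)%N => [hw|].
  have [/hw//|/ltnW kl] := leqP l k.
  rewrite (eq_mean (g := fun x => cosk l x * cosk k x)); last by move=> x; rewrite mulrC.
  by rewrite hw// eq_sym; have [->//|] := eqVneq k l; rewrite !mul0r.
rewrite (eq_mean (fun x => coskM x lk)) mean_coskD /weight addn_eq0 subn_eq0.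
have -> : (k <= l)%N = (k == l) by lia.
have [<-|kl] := eqVneq k l.
  by have [k0|k0] := eqVneq k 0%N; rewrite /=; lra.
have -> : (k == 0%N) && (l == 0%N) = false by lia.
by rewrite /=; lra.
Qed.

Lemma mean_sinkM k l :
  mean (fun x => sink k x * sink l x) = ((k == l) && (k != 0%N))%:R / 2.
Proof.
wlog lk : k l / (l <= k)%N => [hw|].
  have [/hw//|/ltnW kl] := leqP l k.
  rewrite (eq_mean (g := fun x => sink l x * sink k x)); last by move=> x; rewrite mulrC.
  by rewrite hw// eq_sym; have [->//|] := eqVneq k l; rewrite !mul0r.
rewrite (eq_mean (fun x => sinkM x lk)) mean_coskD addn_eq0 subn_eq0.
have -> : (k <= l)%N = (k == l) by lia.
have [<-|kl] := eqVneq k l.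
  by have [k0|k0] := eqVneq k 0%N; rewrite /=; lra.
have -> : (k == 0%N) && (l == 0%N) = false by lia.
by rewrite /=; lra.
Qed.

Lemma mean_sink_coskM k l : mean (fun x => sink k x * cosk l x) = 0.
Proof.
have [lk|/ltnW kl] := leqP l k.
  by rewrite (eq_mean (fun x => sink_coskM x lk)) mean_sinkD.
by rewrite (eq_mean (fun x => mulrC _ _)) (eq_mean (fun x => cosk_sinkM x kl)) mean_sinkD.
Qed.

Definition coefc f k : R := weight k * mean (fun x => f x * cosk k x).
Definition coefs f k : R := weight k * mean (fun x => f x * sink k x).

Definition trigpoly n a b (x : R) : R :=
  \sum_(k < n.+1) (a k * cosk k x + b k * sink k x).

Lemma is_derive_trigpoly n a b (x : R) : is_derive x 1 (trigpoly n a b)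
  (trigpoly n (fun k => freq k * b k) (fun k => - freq k * a k) x).
Proof.
rewrite /trigpoly (_ : (fun x => _) =
  \sum_(k < n.+1) (fun x => a k * cosk k x + b k * sink k x)); last first.
  by apply/funext => y; rewrite fct_sumE.
apply: is_derive_sum => k.
have h1 := is_deriveZ (a k) (is_derive_cosk k x).
have h2 := is_deriveZ (b k) (is_derive_sink k x).
have := is_deriveD h1 h2; congr is_derive.
by rewrite /GRing.scale/=; ring.
Qed.

Lemma continuous_trigpoly n a b : continuous (trigpoly n a b).
Proof. exact: is_derive_continuous (is_derive_trigpoly n a b). Qed.

Lemma trigpoly_periodic n a b : periodic (trigpoly n a b) 1.
Proof. by move=> x; apply: eq_bigr => k _; rewrite cosk_periodic sink_periodic. Qed.

Lemma trigpolyD n a b a' b' x : trigpoly n a b x + trigpoly n a' b' x =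
  trigpoly n (fun k => a k + a' k) (fun k => b k + b' k) x.
Proof. by rewrite -big_split; apply: eq_bigr => k _ /=; ring. Qed.

Lemma trigpolyZ n a b (s : R) x : s * trigpoly n a b x =
  trigpoly n (fun k => s * a k) (fun k => s * b k) x.
Proof. by rewrite mulr_sumr; apply: eq_bigr => k _ /=; ring. Qed.

End trig.

(** * Orthogonality, Parseval, and products of trigonometric polynomials *)

Section trigpoly_theory.
Variable R : realType.
Implicit Types (f g F : R -> R) (a b : nat -> R) (k n : nat).

(** Exactly what expanding [mean (g * trigpoly)] term by term requires; it covers both continuous
    functions and bounded measurable data. *)
Definition integrable_coefs g :=
  forall k, integrable01 (fun x => g x * cosk k x) /\
            integrable01 (fun x => g x * sink k x).

Lemma continuous_integrable_coefs g : continuous g -> integrable_coefs g.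
Proof.
move=> cg k; split; apply: continuous_integrable01 => x; apply: cvgM;
  by [exact: cg|exact: continuous_cosk|exact: continuous_sink].
Qed.

Lemma mean_mul_trigpoly g n a b : integrable_coefs g ->
  mean (fun x => g x * trigpoly n a b x) =
  \sum_(k < n.+1) (a k * coefc g k + b k * coefs g k) / weight R k.
Proof.
move=> ig.
rewrite (eq_mean (g := fun x => \sum_(k < n.+1)
  (a k * (g x * cosk k x) + b k * (g x * sink k x)))); last first.
  by move=> x; rewrite mulr_sumr; apply: eq_bigr => k _; ring.
rewrite mean_sum; last first.
  by move=> k _; have [? ?] := ig k; apply: integrable01D; exact: integrable01Z.
apply: eq_bigr => k _; have [? ?] := ig k.
rewrite meanD ?meanZ//; [|exact: integrable01Z..].
have := weight_gt0 R k; rewrite /coefc /coefs; move: (weight R k) => w w0.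
by field; rewrite gt_eqF.
Qed.

Lemma coefc_cosk k l : coefc (@cosk R k) l = (k == l)%:R.
Proof.
rewrite /coefc mean_coskM; have := weight_gt0 R k; have [->|_] := eqVneq k l.
  by move=> w0; rewrite mul1r mulfV// gt_eqF.
by rewrite mul0r mulr0.
Qed.

Lemma coefs_cosk k l : coefs (@cosk R k) l = 0.
Proof.
rewrite /coefs (eq_mean (g := fun x => sink l x * cosk k x)).
  by rewrite mean_sink_coskM mulr0.
by move=> x; rewrite mulrC.
Qed.

Lemma coefc_sink k l : coefc (@sink R k) l = 0.
Proof. by rewrite /coefc mean_sink_coskM mulr0. Qed.

Lemma coefs_sink k l : coefs (@sink R k) l = ((k == l) && (k != 0%N))%:R.
Proof.
rewrite /coefs mean_sinkM /weight; have [<-|_]/= := eqVneq k l.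
  by case: eqVneq => //=; lra.
by lra.
Qed.

Lemma sum_ord_pick (n l : nat) (h : nat -> R) :
  \sum_(k < n) h k * (k == l :> nat)%:R = if (l < n)%N then h l else 0.
Proof.
case: ifPn => ln.
  rewrite (bigD1 (Ordinal ln))//= eqxx mulr1 big1 ?addr0// => i.
  by rewrite -val_eqE/= => /negbTE->; rewrite mulr0.
by rewrite big1// => i _; case: eqVneq => [il|]; [move: ln; rewrite -il ltn_ord|rewrite mulr0].
Qed.

Lemma coefc_trigpoly n a b l :
  coefc (trigpoly n a b) l = if (l <= n)%N then a l else 0.
Proof.
rewrite /coefc (eq_mean (g := fun x => cosk l x * trigpoly n a b x)); last first.
  by move=> x; rewrite mulrC.
rewrite mean_mul_trigpoly; last exact/continuous_integrable_coefs/continuous_cosk.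
rewrite -(sum_ord_pick n.+1) mulr_sumr; apply: eq_bigr => k _.
rewrite coefc_cosk coefs_cosk mulr0 addr0 eq_sym.
have [->|_] := eqVneq; last by rewrite !(mulr0, mul0r).
by have := weight_gt0 R l => w0; field; rewrite gt_eqF.
Qed.

(** The entry [b 0] multiplies [sink 0 = 0] and cannot be recovered, hence the condition [0 < l]. *)
Lemma coefs_trigpoly n a b l :
  coefs (trigpoly n a b) l = if (0 < l <= n)%N then b l else 0.
Proof.
rewrite /coefs (eq_mean (g := fun x => sink l x * trigpoly n a b x)); last first.
  by move=> x; rewrite mulrC.
rewrite mean_mul_trigpoly; last exact/continuous_integrable_coefs/continuous_sink.
transitivity (\sum_(k < n.+1) ((l != 0%N)%:R * b k) * (k == l :> nat)%:R).
  rewrite mulr_sumr; apply: eq_bigr => k _.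
  rewrite coefc_sink coefs_sink mulr0 add0r [(l == k :> nat)]eq_sym.
  have [->|_]/= := eqVneq; last by rewrite !(mulr0, mul0r).
  by have := weight_gt0 R l => w0; field; rewrite gt_eqF.
rewrite (sum_ord_pick n.+1 l (fun k => (l != 0%N)%:R * b k)) ltnS lt0n.
by case: (l != 0%N) => /=; case: ifP => _; rewrite ?mul1r ?mul0r.
Qed.

Lemma sum_weight n (h : nat -> R) :
  \sum_(k < n.+1) h k / weight R k = h 0%N + 2^-1 * \sum_(1 <= k < n.+1) h k.
Proof.
rewrite -(big_mkord xpredT (fun k => h k / weight R k)) big_ltn// {1}/weight eqxx divr1.
congr (_ + _); rewrite mulr_sumr; apply: eq_big_nat => k /andP[k0 _].
by rewrite /weight gtn_eqF// mulrC.
Qed.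

Lemma parseval n a b a' b' :
  mean (fun x => trigpoly n a b x * trigpoly n a' b' x) =
  a 0%N * a' 0%N + 2^-1 * \sum_(1 <= k < n.+1) (a k * a' k + b k * b' k).
Proof.
rewrite mean_mul_trigpoly; last exact/continuous_integrable_coefs/continuous_trigpoly.
rewrite (sum_weight n (fun k => a' k * coefc (trigpoly n a b) k +
  b' k * coefs (trigpoly n a b) k)) coefc_trigpoly coefs_trigpoly/= mulr0 addr0 mulrC.
congr (_ + _ * _); apply: eq_big_nat => k /andP[k0 kn].
by rewrite coefc_trigpoly coefs_trigpoly k0 -ltnS kn/=; ring.
Qed.

Definition is_trigpoly n f := exists a b, f =1 trigpoly n a b.

Lemma is_trigpolyD n f g : is_trigpoly n f -> is_trigpoly n g ->
  is_trigpoly n (fun x => f x + g x).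
Proof.
move=> [a [b fE]] [a' [b' gE]]; exists (fun k => a k + a' k), (fun k => b k + b' k) => x.
by rewrite fE gE trigpolyD.
Qed.

Lemma is_trigpolyZ n (s : R) f : is_trigpoly n f -> is_trigpoly n (fun x => s * f x).
Proof. by move=> [a [b fE]]; exists (fun k => s * a k), (fun k => s * b k) => x; rewrite fE trigpolyZ. Qed.

Lemma eq_is_trigpoly n f g : f =1 g -> is_trigpoly n f -> is_trigpoly n g.
Proof. by move=> fg [a [b fE]]; exists a, b => x; rewrite -fg. Qed.

Lemma is_trigpoly_cosk n k : (k <= n)%N -> is_trigpoly n (@cosk R k).
Proof.
move=> kn; exists (fun j => (j == k)%:R), (fun=> 0) => x.
transitivity (\sum_(j < n.+1) cosk j x * (j == k :> nat)%:R).
  by rewrite (sum_ord_pick n.+1 k (fun j => cosk j x)) ltnS kn.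
by apply: eq_bigr => j _; rewrite mul0r addr0 mulrC.
Qed.

Lemma is_trigpoly_sink n k : (k <= n)%N -> is_trigpoly n (@sink R k).
Proof.
move=> kn; exists (fun=> 0), (fun j => (j == k)%:R) => x.
transitivity (\sum_(j < n.+1) sink j x * (j == k :> nat)%:R).
  by rewrite (sum_ord_pick n.+1 k (fun j => sink j x)) ltnS kn.
by apply: eq_bigr => j _; rewrite mul0r add0r mulrC.
Qed.

Lemma is_trigpoly_sum n m (h : nat -> R -> R) :
  (forall k, (k < m)%N -> is_trigpoly n (h k)) ->
  is_trigpoly n (fun x => \sum_(k < m) h k x).
Proof.
elim: m => [_|m IH hm].
  exists (fun=> 0), (fun=> 0) => x; rewrite big_ord0.
  by rewrite /trigpoly big1// => i _; rewrite !mul0r addr0.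
apply: (@eq_is_trigpoly _ (fun x => \sum_(k < m) h k x + h m x)).
  by move=> x; rewrite big_ord_recr.
apply: is_trigpolyD; last exact: hm.
by apply: IH => k km; apply: hm; rewrite ltnS ltnW.
Qed.

Lemma is_trigpoly_coskM n k l : (k + l <= n)%N ->
  is_trigpoly n (fun x : R => cosk k x * cosk l x).
Proof.
wlog lk : k l / (l <= k)%N => [hw|] kln.
  have [/hw|/ltnW kl] := leqP l k; first exact.
  by apply: eq_is_trigpoly (hw _ _ kl _) => [x|]; [rewrite mulrC|rewrite addnC].
apply: eq_is_trigpoly; first by move=> x; exact: esym (coskM x lk).
by apply: is_trigpolyD; apply: is_trigpolyZ; apply: is_trigpoly_cosk; lia.
Qed.

Lemma is_trigpoly_sinkM n k l : (k + l <= n)%N ->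
  is_trigpoly n (fun x : R => sink k x * sink l x).
Proof.
wlog lk : k l / (l <= k)%N => [hw|] kln.
  have [/hw|/ltnW kl] := leqP l k; first exact.
  by apply: eq_is_trigpoly (hw _ _ kl _) => [x|]; [rewrite mulrC|rewrite addnC].
apply: eq_is_trigpoly; first by move=> x; exact: esym (sinkM x lk).
by apply: is_trigpolyD; apply: is_trigpolyZ; apply: is_trigpoly_cosk; lia.
Qed.

Lemma is_trigpoly_sink_coskM n k l : (k + l <= n)%N ->
  is_trigpoly n (fun x : R => sink k x * cosk l x).
Proof.
move=> kln; have [lk|/ltnW kl] := leqP l k.
  apply: eq_is_trigpoly; first by move=> x; exact: esym (sink_coskM x lk).
  by apply: is_trigpolyD; apply: is_trigpolyZ; apply: is_trigpoly_sink; lia.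
apply: (@eq_is_trigpoly _ (fun x => cosk l x * sink k x)) => [x|]; first by rewrite mulrC.
apply: eq_is_trigpoly; first by move=> x; exact: esym (cosk_sinkM x kl).
by apply: is_trigpolyD; apply: is_trigpolyZ; apply: is_trigpoly_sink; lia.
Qed.

(** Product-to-sum formulas add degrees. The coefficients stay existential because
    [is_trigpoly_coef] identifies them afterwards. *)
Lemma is_trigpolyM n m a b a' b' :
  is_trigpoly (n + m) (fun x => trigpoly n a b x * trigpoly m a' b' x).
Proof.
apply: (@eq_is_trigpoly _ (fun x => \sum_(k < n.+1) \sum_(l < m.+1)
   ((a k * cosk k x + b k * sink k x) * (a' l * cosk l x + b' l * sink l x)))).
  by move=> x; rewrite /trigpoly mulr_suml; apply: eq_bigr => k _; rewrite mulr_sumr.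
apply: (is_trigpoly_sum (h := fun k x => \sum_(l < m.+1)
   ((a k * cosk k x + b k * sink k x) * (a' l * cosk l x + b' l * sink l x)))) => k kn.
apply: (is_trigpoly_sum (h := fun l x => 
   ((a k * cosk k x + b k * sink k x) * (a' l * cosk l x + b' l * sink l x)))) => l lm.
apply: (@eq_is_trigpoly _ (fun x =>
   (a k * a' l) * (cosk k x * cosk l x) + (b k * b' l) * (sink k x * sink l x) +
   ((b k * a' l) * (sink k x * cosk l x) + (a k * b' l) * (sink l x * cosk k x)))).
  by move=> x; ring.
apply: is_trigpolyD; apply: is_trigpolyD; apply: is_trigpolyZ.
- by apply: is_trigpoly_coskM; lia.
- by apply: is_trigpoly_sinkM; lia.
- by apply: is_trigpoly_sink_coskM; lia.
- by apply: is_trigpoly_sink_coskM; lia.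
Qed.

Lemma is_trigpoly_coef n f : is_trigpoly n f -> f =1 trigpoly n (coefc f) (coefs f).
Proof.
move=> [a [b fE]] x; have -> : f = trigpoly n a b by exact/funext.
apply: eq_bigr => k _; rewrite coefc_trigpoly coefs_trigpoly -ltnS ltn_ord.
by have [->|] := posnP k; rewrite ?sink0 ?mulr0//=.
Qed.

End trigpoly_theory.

(** * The Dirichlet kernel *)

Section fourier_proj.
Variable R : realType.
Implicit Types (f g F : R -> R) (a b : nat -> R) (k n : nat).

(** The terms of frequency [k] and [- k] have the same real part [S k]. Folding the sum at frequency
    0, which is index [n], counts every positive frequency twice, and this is the factor
    [weight]. *)
Lemma fourier_proj_trigpoly n f :
  fourier_proj n f =1 trigpoly n (coefc f) (coefs f).
Proof.
move=> x; pose T (z : int) := complex.Re (fourier_coef f z * expi (2 * pi * z%:~R * x)).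
pose S k := mean (fun y => f y * cosk k y) * cosk k x +
            mean (fun y => f y * sink k y) * sink k x.
have TP k : T k%:Z = S k.
  have ReE : complex.Re (fourier_coef f k%:Z) = mean (fun y => f y * cosk k y).
    by apply: eq_mean => y /=; rewrite cosN mul0r subr0.
  have ImE : complex.Im (fourier_coef f k%:Z) = - mean (fun y => f y * sink k y).
    by rewrite -meanN; apply: eq_mean => y /=; rewrite sinN mul0r addr0 mulrN.
  rewrite /T /S -ReE -[mean (fun y => f y * sink k y)]opprK -ImE mulNr.
  by case: (fourier_coef f _).
have TN k : T (- k%:Z) = S k.
  rewrite -TP /T fourier_coefN mulrNz mulrN mulNr /expi cosN sinN.
  by case: (fourier_coef f _) => c d /=; ring.
have -> : fourier_proj n f x = \sum_(j < (2 * n).+1) T (j%:Z - n%:Z).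
  by rewrite /fourier_proj /fourier_sum; rewrite (big_morph (@complex.Re R) (id1 := 0) (op1 := +%R))// => -[? ?] [? ?].
have -> : trigpoly n (coefc f) (coefs f) x = \sum_(k < n.+1) weight R k * S k.
  by apply: eq_bigr => k _; rewrite /coefc /coefs /S; ring.
rewrite -(big_mkord xpredT (fun j => T (j%:Z - n%:Z))).
rewrite (big_cat_nat (n := n))//=; last by lia.
rewrite (_ : \sum_(0 <= i < n) T (i%:Z - n%:Z) = \sum_(k < n) S k.+1); last first.
  rewrite big_nat_rev big_mkord; apply: eq_bigr => k _ /=; rewrite -TN; congr T.
  by have := ltn_ord k; lia.
rewrite (_ : \sum_(n <= i < _) _ = \sum_(k < n.+1) S k); last first.
  have := big_addn 0 (2 * n).+1 n xpredT (fun i => T (i%:Z - n%:Z)).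
  rewrite add0n (_ : ((2 * n).+1 - n = n.+1)%N); last by lia.
  by move=> ->; rewrite big_mkord; apply: eq_bigr => k _; rewrite -TP; congr T; lia.
rewrite big_ord_recl [RHS]big_ord_recl /weight/= mul1r addrCA -big_split/=.
by congr (_ + _); apply: eq_bigr => k _; rewrite /bump/= add1n; lra.
Qed.

(** As a function of [y] this is the usual kernel at [x - y], kept as a trigonometric polynomial so
    that [parseval] and [mean_mul_trigpoly] apply directly. *)
Definition dirichlet n (x : R) := trigpoly n
  (fun k => weight R k * cosk k x) (fun k => weight R k * sink k x).

Lemma trigpoly_dirichlet n f x : integrable_coefs f ->
  trigpoly n (coefc f) (coefs f) x = mean (fun y => f y * dirichlet n x y).
Proof.
move=> fi; rewrite mean_mul_trigpoly//; apply: eq_bigr => k _.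
by have := weight_gt0 R k => w0; field; rewrite gt_eqF.
Qed.

Lemma cosk_diff k (x y : R) : cosk k x * cosk k y + sink k x * sink k y =
  cos (2 * k%:R * (pi * (x - y))).
Proof. by rewrite -cosB /freq; congr cos; ring. Qed.

(** Frequency [k] contributes [2 cos (2 k t) sin t = sin ((2 k + 1) t) - sin ((2 k - 1) t)] with
    [t = pi (x - y)], so the sum telescopes. *)
Lemma dirichletM_sin n (x y : R) :
  dirichlet n x y * sin (pi * (x - y)) = sin ((2 * n).+1%:R * (pi * (x - y))).
Proof.
rewrite /dirichlet; elim: n => [|n IH].
  by rewrite /trigpoly big_ord1 /weight/= !cosk0 !sink0 !mul1r mulr0 addr0 mul1r.
rewrite /trigpoly big_ord_recr/= mulrDl {}IH /weight/=.
rewrite -!mulrA -mulrDr cosk_diff; set t := pi * (x - y).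
rewrite (_ : (2 * n.+1).+1%:R * t = 2 * n.+1%:R * t + t); last first.
  by rewrite -natr1 natrM; ring.
rewrite (_ : (2 * n).+1%:R * t = 2 * n.+1%:R * t - t); last first.
  by rewrite -natr1 natrM -natr1; ring.
by rewrite sinB sinD; ring.
Qed.

Lemma norm_sin_mulrn (t : R) k : `|sin (k%:R * t)| <= k%:R * `|sin t|.
Proof.
elim: k => [|k IH]; first by rewrite !mul0r sin0 normr0.
rewrite -natr1 mulrDl mul1r sinD mulrDl mul1r.
apply: (le_trans (ler_normD _ _)); rewrite !normrM; apply: lerD.
  by apply: le_trans IH; rewrite ler_piMr// cos_max.
by rewrite ler_piMl// cos_max.
Qed.

Lemma mean_dirichlet_sqr n x : mean (fun y => dirichlet n x y ^+ 2) = 1 + 2 * n%:R.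
Proof.
rewrite (eq_mean (g := fun y => dirichlet n x y * dirichlet n x y))// parseval.
rewrite /weight/= cosk0 !mul1r; congr (_ + _).
rewrite (eq_big_nat _ _ (F2 := fun=> 4)); last first.
  move=> k /andP[k0 _]; rewrite gtn_eqF//.
  transitivity (4 * (cosk k x ^+ 2 + sink k x ^+ 2)); first by ring.
  by rewrite cos2Dsin2 mulr1.
by rewrite sumr_const_nat subSS subn0 -mulr_natr; lra.
Qed.

(* Splits the Dirichlet kernel with the localiser
   [n^-1 * \sum_(1 <= k <= n) cos (2 pi k (x - y))], which is small in [L^2]
   and [O(n |sin (pi (x - y))|)]-close to 1. *)
Lemma mean_norm_dirichlet_le (N n : nat) (x : R) : (0 < n)%N -> (0 < N)%N ->
  (N <= 8 * n ^ 3)%N -> mean (fun y => `|dirichlet N x y|) <= 15 * n%:R.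
Proof.
move=> n0 N0 Nn; have nR : 0 < n%:R :> R by rewrite ltr0n.
pose K := trigpoly n (fun k => (0 < k)%N%:R / n%:R * cosk k x)
                     (fun k => (0 < k)%N%:R / n%:R * sink k x).
have KE y : K y = n%:R^-1 * \sum_(1 <= k < n.+1) cos (2 * k%:R * (pi * (x - y))).
  rewrite /K /trigpoly -(big_mkord xpredT (fun k => (0 < k)%N%:R / n%:R * cosk k x * cosk k y +
    (0 < k)%N%:R / n%:R * sink k x * sink k y)).
  rewrite big_ltn//= !mul0r !add0r mulr_sumr; apply: eq_big_nat => k /andP[k0 _].
  by rewrite k0 -cosk_diff /=; ring.
have K2 : mean (fun y => K y ^+ 2) = (2 * n%:R)^-1.
  rewrite (eq_mean (g := fun y => K y * K y))// parseval/= !mul0r add0r.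
  rewrite (eq_big_nat _ _ (F2 := fun=> n%:R ^- 2)); last first.
    move=> k /andP[k0 _]; rewrite k0 /=.
    transitivity (n%:R ^- 2 * (cosk k x ^+ 2 + sink k x ^+ 2)).
      by field; rewrite gt_eqF.
    by rewrite cos2Dsin2 mulr1.
  rewrite sumr_const_nat subSS subn0 -mulr_natr; field; rewrite gt_eqF//.
(* Each [1 - cos (2 k t)] equals [2 sin (k t) ^ 2]; one factor is bounded by [k |sin t|], the other
   by 1. A bound linear in [|sin t|] is what [dirichletM_sin] can absorb. *)
have K1 y : `|1 - K y| <= 2 * n%:R * `|sin (pi * (x - y))|.
  set s := `|sin _|; have -> : 1 - K y = n%:R^-1 * \sum_(1 <= k < n.+1)
      (1 - cos (2 * k%:R * (pi * (x - y)))).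
    rewrite big_split/= sumrN sumr_const_nat subSS subn0 KE.
    by rewrite [RHS]mulrBr mulVf ?gt_eqF.
  rewrite normrM gtr0_norm ?invr_gt0// ler_pdivrMl//.
  apply: (le_trans (ler_norm_sum _ _ _)).
  apply: (@le_trans _ _ (\sum_(1 <= k < n.+1) 2 * n%:R * s)); last first.
    by rewrite sumr_const_nat subSS subn0 -[leLHS]mulr_natl.
  apply: ler_sum_nat => k /andP[k0 kn].
  rewrite (_ : 2 * k%:R * _ = (k%:R * (pi * (x - y))) *+ 2); last first.
    by rewrite -[RHS]mulr_natl; ring.
  rewrite cos_mulr2n cos2sin2 (_ : 1 - _ = 2 * `|sin (k%:R * (pi * (x - y)))| ^+ 2);
    last by rewrite real_normK ?num_real//; lra.
  rewrite ger0_norm ?mulr_ge0// -mulrA ler_pM2l// expr2.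
  apply: (@le_trans _ _ (k%:R * s * 1)); last by rewrite mulr1 ler_wpM2r ?normr_ge0 ?ler_nat.
  by apply: ler_pM => //; [exact: norm_sin_mulrn|exact: sin_max].
(* Weight for Young's inequality: the squared L^2 norms of the kernel and of [K] are [1 + 2 N], with
   [N <= 8 n ^ 3], and [1 / (2 n)], so this choice makes both contributions [O(n)]. *)
pose d : R := n%:R ^- 2.
have d0 : 0 < d by rewrite invr_gt0 exprn_gt0.
have step y : `|dirichlet N x y| <=
    2^-1 * d * dirichlet N x y ^+ 2 + ((2 * d)^-1 * K y ^+ 2 + 2 * n%:R).
  have h1 : `|dirichlet N x y| <= `|dirichlet N x y * K y| +
      `|dirichlet N x y * (1 - K y)|.
    by apply: le_trans (ler_normD _ _); rewrite -mulrDr [K y + _]addrC subrK mulr1.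
  have h2 : `|dirichlet N x y * (1 - K y)| <= 2 * n%:R.
    rewrite normrM; apply: (le_trans (ler_wpM2l (normr_ge0 _) (K1 y))).
    rewrite mulrCA ler_piMr ?mulr_ge0// -normrM dirichletM_sin; exact: sin_max.
  have h3 : `|dirichlet N x y * K y| <=
      2^-1 * d * dirichlet N x y ^+ 2 + (2 * d)^-1 * K y ^+ 2.
    rewrite normrM -[dirichlet N x y ^+ 2]real_normK ?num_real//.
    rewrite -[K y ^+ 2]real_normK ?num_real//.
    rewrite -subr_ge0; set p := `|_|; set q := `|_|.
    rewrite (_ : _ - _ = (2 * d)^-1 * (d * p - q) ^+ 2).
      by rewrite mulr_ge0 ?sqr_ge0// invr_ge0 mulr_ge0// ltW.
    by field; rewrite gt_eqF.
  by rewrite addrA; apply: (le_trans h1); apply: lerD.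
have cD := continuous_trigpoly (n := N)
  (a := fun k => weight R k * cosk k x) (b := fun k => weight R k * sink k x).
have cK : continuous K := continuous_trigpoly (n := n) (a := _) (b := _).
have i1 : integrable01 (fun y => dirichlet N x y ^+ 2).
  by apply: continuous_integrable01 => y; apply: cvgM; exact: cD.
have i2 : integrable01 (fun y => K y ^+ 2).
  by apply: continuous_integrable01 => y; apply: cvgM; exact: cK.
have i3 : integrable01 (fun _ : R => 2 * n%:R).
  by apply: continuous_integrable01 => y; exact: cvg_cst.
have i4 : integrable01 (fun y => `|dirichlet N x y|).
  by apply: continuous_integrable01 => y; apply: cvg_norm; exact: cD.
apply: (le_trans (le_mean i4 _ step)).
  by do ?apply: integrable01D => //; exact: integrable01Z.
rewrite meanD; [|exact: integrable01Z|by apply: integrable01D => //; exact: integrable01Z].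
rewrite meanD//; last exact: integrable01Z.
rewrite mean_cst !meanZ// mean_dirichlet_sqr K2 /d.
have NR : N%:R <= 8 * n%:R ^+ 3 :> R by rewrite -natrX -natrM ler_nat.
have N1 : 1 <= N%:R :> R by rewrite ler1n.
have n1 : 1 <= n%:R :> R by rewrite ler1n.
rewrite (_ : _ * _ + _ = n%:R ^- 2 * (2^-1 * (1 + 2 * N%:R) + (4^-1 + 2) * n%:R ^+ 3));
  last by field; rewrite gt_eqF.
rewrite ler_pdivrMl ?exprn_gt0//.
have -> : n%:R ^+ 2 * (15 * n%:R) = 15 * n%:R ^+ 3 :> R by ring.
move: NR; set c := n%:R ^+ 3; lra.
Qed.

End fourier_proj.

(** * Bounds on the projected datum *)

Section torus.
Variable R : realType.
Local Notation mu := (@lebesgue_measure R).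
Implicit Types (f g F : R -> R) (a b : nat -> R) (k n : nat).

Lemma torus_measureT : torus_measure R setT = 1%E.
Proof.
by rewrite /torus_measure/= /mrestr setTI lebesgue_measure_itv/= lte01 oppr0 adde0.
Qed.

Lemma Linfty_normE g :
  Linfty_norm g = ess_sup (torus_measure R) (abse \o (EFin \o g)).
Proof.
by rewrite /Linfty_norm unlock/= torus_measureT lte01.
Qed.

Lemma Linfty_norm_le g (C : R) :
  (forall x, `|g x| <= C) -> (Linfty_norm g <= C%:E)%E.
Proof.
by move=> gC; rewrite Linfty_normE; apply/ess_supP/nearW => x /=; rewrite lee_fin.
Qed.

Lemma periodic_int g (z : int) (x : R) : periodic g 1 -> g (x + z%:~R) = g x.
Proof.
move=> pg; case: z => n; first exact: periodicn pg n x.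
by rewrite NegzE mulrNz -[in RHS](subrK n.+1%:R x) (periodicn pg n.+1).
Qed.

Lemma periodic_itv g (x : R) : periodic g 1 -> exists2 y, 0 <= y < 1 & g y = g x.
Proof.
move=> pg; exists (x - (Num.floor x)%:~R); last by rewrite -mulrNz periodic_int.
by have := floor_itv x; rewrite intrD => /andP[? ?]; apply/andP; split; lra.
Qed.

Lemma Linfty_norm_ge g (C : R) (x : R) : periodic g 1 -> continuous g ->
  (Linfty_norm g <= C%:E)%E -> `|g x| <= C.
Proof.
move=> pg cg; rewrite Linfty_normE => /ess_supP [A [mA A0 sA]].
(* The representative is taken in [[0, 1[] so that a short interval to its right stays inside
   [[0, 1]], where the measure lives. If [|g y|] exceeded [C], that interval would have positive
   length inside a null set. *)
have [y /andP[y0 y1] <-] := periodic_itv x pg.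
rewrite leNgt; apply/negP => Cg.
have : \forall z \near y, C < `|g z|.
  have cn : continuous (fun z => `|g z|) by move=> z; apply: cvg_norm; exact: cg.
  exact: (cvgr_gt _ (cn y)).
move=> [e/= e0 yeC].
pose d := Num.min (e / 2) (1 - y).
have d0 : 0 < d by rewrite /d lt_min subr_gt0 y1 divr_gt0.
have sub : `]y, (y + d)[ `<=` A `&` `[0%R, 1%R].
  move=> z /=; rewrite in_itv/= => /andP[yz zd].
  have zd1 : z < y + e / 2 by apply: (lt_le_trans zd); rewrite lerD2l ge_min lexx.
  have zd2 : z < 1.
    by apply: (lt_le_trans zd); rewrite -lerBrDl ge_min lexx orbT.
  split; last by rewrite /= in_itv/=; apply/andP; split; lra.
  apply: sA => /=; rewrite lee_fin => gz.
  suff : C < `|g z| by rewrite ltNge gz.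
  by apply: yeC; rewrite /= ltr_norml; apply/andP; split; lra.
have : (mu `]y, (y + d)%R[%classic <= 0)%E.
  rewrite -A0; apply: le_measure => //; rewrite inE//.
  by apply: measurableI.
rewrite lebesgue_measure_itv/= lte_fin ltrDl d0 -EFinB lee_fin; lra.
Qed.

Lemma measurable_cosk k : measurable_fun setT (@cosk R k).
Proof. by apply: continuous_measurable_fun; exact: continuous_cosk. Qed.

Lemma measurable_sink k : measurable_fun setT (@sink R k).
Proof. by apply: continuous_measurable_fun; exact: continuous_sink. Qed.

Lemma measurable_integrable_coefs f (M : R) : measurable_fun setT f ->
  (forall x, `|f x| <= M) -> integrable_coefs f.
Proof.
move=> mf fM k.
suff H g : measurable_fun setT g -> (forall x, `|g x| <= 1) ->
    integrable01 (fun x => f x * g x).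
  split; apply: H.
  - exact: measurable_cosk.
  - by move=> x; exact: cos_max.
  - exact: measurable_sink.
  - by move=> x; exact: sin_max.
move=> mg g1; apply: measurable_bounded_integrable => //.
- by rewrite /= lebesgue_measure_itv/= lte01 oppr0 adde0 ltry.
- by apply: measurable_funTS; exact: measurable_funM.
exists M; split; first exact: num_real.
move=> C MC x _ /=; rewrite normrM; apply: le_trans (ltW MC).
apply: le_trans (fM x); by rewrite ler_piMr.
Qed.

Lemma eq_ae_coef f f' : measurable_fun setT f -> measurable_fun setT f' ->
  (\forall x \ae torus_measure R, f x = f' x) ->
  coefc f = coefc f' /\ coefs f = coefs f'.
Proof.
move=> mf mf' [A [mA A0 sA]].
suff H g : measurable_fun setT g ->
    mean (fun x => f x * g x) = mean (fun x => f' x * g x).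
  by split; apply/funext => k; rewrite /coefc /coefs; congr (_ * _); apply: H;
    [exact: measurable_cosk|exact: measurable_sink].
move=> mg; rewrite /mean /Rintegral; congr fine.
apply: ae_eq_integral => //.
- by apply/measurable_EFinP/measurable_funTS; exact: measurable_funM.
- by apply/measurable_EFinP/measurable_funTS; exact: measurable_funM.
exists (A `&` `[0%R, 1%R]); split => //; first exact: measurableI.
move=> x /= /not_implyP[x01 fg]; split => //; apply: sA => /= ff.
by apply: fg; rewrite ff.
Qed.

(** Truncating [f] at heights [- M] and [M] changes it only on a null set of the torus, which the
    coefficients do not see; the essential bound becomes a pointwise one. *)
Lemma Linfty_bounded_coef f (M : R) : Linfty_torus f -> Linfty_norm f = M%:E ->
  exists f', [/\ measurable_fun setT f', forall x, `|f' x| <= M,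
    coefc f = coefc f' & coefs f = coefs f'].
Proof.
move=> [pf /andP[mf _]] fM.
have {}mf : measurable_fun setT f by move: mf; rewrite inE.
have M0 : 0 <= M by rewrite -lee_fin -fM Lnorm_ge0.
pose f' x := Num.max (- M) (Num.min M (f x)).
have mf' : measurable_fun setT f'.
  apply: (measurable_maxr (f := fun=> - M)) => //.
  exact: (measurable_minr (f := fun=> M)).
exists f'.
have ae : \forall x \ae torus_measure R, f x = f' x.
  have /ess_supP : (ess_sup (torus_measure R) (abse \o (EFin \o f)) <= M%:E)%E.
    by rewrite -Linfty_normE fM.
  apply: filterS => x /=; rewrite lee_fin ler_norml => /andP[h1 h2].
  by rewrite /f' min_r// max_r.
have [-> ->] := eq_ae_coef mf mf' ae; split => // x.
by rewrite ler_norml /f' le_max lexx/= ge_max ge_min lexx/= andbT; lra.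
Qed.

(** The sup norm of the datum is paired with the L^1 norm of the kernel. *)
Lemma fourier_proj_bound f (M : R) (N n : nat) (x : R) :
  Linfty_torus f -> Linfty_norm f = M%:E -> (0 < n)%N -> (0 < N)%N ->
  (N <= 8 * n ^ 3)%N -> `|fourier_proj N f x| <= 15 * n%:R * M.
Proof.
move=> ft fM n0 N0 Nn; have [f' [mf' f'M cE sE]] := Linfty_bounded_coef ft fM.
have M0 : 0 <= M by exact: le_trans (f'M 0).
have fi := measurable_integrable_coefs mf' f'M.
rewrite fourier_proj_trigpoly cE sE trigpoly_dirichlet//.
have iD : integrable01 (fun y => M * `|dirichlet N x y|).
  apply: continuous_integrable01 => y; apply: cvgM; first exact: cvg_cst.
  by apply: cvg_norm; exact: continuous_trigpoly.
have ifD : integrable01 (fun y => f' y * dirichlet N x y).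
  rewrite (_ : (fun y => _) = fun y => \sum_(k < N.+1)
    ((weight R k * cosk k x) * (f' y * cosk k y) +
     (weight R k * sink k x) * (f' y * sink k y))).
    apply: integrable01_sum => k _; have [? ?] := fi k.
    by apply: integrable01D; exact: integrable01Z.
  by apply/funext => y; rewrite mulr_sumr; apply: eq_bigr => k _; ring.
apply: (@le_trans _ _ (mean (fun y => M * `|dirichlet N x y|))); last first.
  rewrite meanZ 1?mulrC; last first.
    apply: continuous_integrable01 => y.
    by apply: cvg_norm; exact: continuous_trigpoly.
  by rewrite ler_wpM2r// mean_norm_dirichlet_le.
have h y : `|f' y * dirichlet N x y| <= M * `|dirichlet N x y|.
  by rewrite normrM ler_wpM2r.
rewrite ler_norml; apply/andP; split.
  rewrite -meanN; apply: le_mean => //.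
    rewrite (_ : (fun _ => _) = fun y => -1 * (M * `|dirichlet N x y|)).
      exact: integrable01Z.
    by apply/funext => y; rewrite mulN1r.
  by move=> y; have := h y; rewrite ler_norml => /andP[].
by apply: le_mean => // y; exact: le_trans (ler_norm _) (h y).
Qed.

(** Integrate [2 f' p - p ^ 2 <= f' ^ 2 <= M ^ 2], where [p] is the projection of the truncated
    datum [f']: the means of [f' p] and of [p ^ 2] are both equal to the left-hand side. *)
Lemma bessel f (M : R) (N : nat) : Linfty_torus f -> Linfty_norm f = M%:E ->
  coefc f 0 ^+ 2 +
    2^-1 * \sum_(1 <= k < N.+1) (coefc f k ^+ 2 + coefs f k ^+ 2) <= M ^+ 2.
Proof.
move=> ft fM; have [f' [mf' f'M -> ->]] := Linfty_bounded_coef ft fM.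
have fi := measurable_integrable_coefs mf' f'M.
set p := trigpoly N (coefc f') (coefs f').
have cp : continuous p by exact: continuous_trigpoly.
have ip : integrable01 (fun y => p y * p y).
  by apply: continuous_integrable01 => y; apply: cvgM; exact: cp.
have ifp : integrable01 (fun y => f' y * p y).
  rewrite (_ : (fun y => _) = fun y => \sum_(k < N.+1)
    (coefc f' k * (f' y * cosk k y) + coefs f' k * (f' y * sink k y))).
    apply: integrable01_sum => k _; have [? ?] := fi k.
    by apply: integrable01D; exact: integrable01Z.
  by apply/funext => y; rewrite mulr_sumr; apply: eq_bigr => k _; ring.
have : mean (fun y => 2 * (f' y * p y) + -1 * (p y * p y)) <= mean (fun=> M ^+ 2).
  apply: le_mean.
  - by apply: integrable01D; exact: integrable01Z.
  - by apply: continuous_integrable01 => y; exact: cvg_cst.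
  move=> y; apply: (@le_trans _ _ (f' y ^+ 2)).
    by rewrite -subr_ge0 (_ : _ - _ = (f' y - p y) ^+ 2) ?sqr_ge0//; ring.
  rewrite -[leLHS]real_normK ?num_real// ler_sqr ?nnegrE//.
  exact: le_trans (f'M y).
rewrite mean_cst meanD; [|exact: integrable01Z..].
rewrite !meanZ// parseval mean_mul_trigpoly//.
rewrite (sum_weight N (fun k => coefc f' k * coefc f' k + coefs f' k * coefs f' k)).
have -> : coefs f' 0 = 0.
  rewrite /coefs (eq_mean (g := fun=> 0)) ?mean_cst ?mulr0// => y.
  by rewrite sink0 mulr0.
rewrite (eq_big_nat _ _ (F2 := fun k => coefc f' k ^+ 2 + coefs f' k ^+ 2)).
  by rewrite -!expr2; lra.
by move=> k _; rewrite -!expr2.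
Qed.

End torus.

(** * Energy estimates at a fixed time *)

Section energy.
Variable R : realType.
Implicit Types (f g F : R -> R) (a b : nat -> R) (k n N : nat).

(* Half the coefficients' square sum is the squared L^2 norm of the [j]-th
   derivative; the mean is left out so that energies increase with [j]. *)
Definition energy (j : nat) N a b : R :=
  2^-1 * \sum_(1 <= k < N.+1) freq R k ^+ (2 * j) * (a k ^+ 2 + b k ^+ 2).

Lemma energy_ge0 j N a b : 0 <= energy j N a b.
Proof.
rewrite mulr_ge0// sumr_ge0// => k _.
by rewrite mulr_ge0 ?exprn_ge0 ?freq_ge0// addr_ge0 ?sqr_ge0.
Qed.

Lemma freq_ge k : k%:R <= freq R k.
Proof. by rewrite /freq ler_peMl//; have := pi_ge2 R; lra. Qed.

(** Poincare's inequality, from [freq k >= k >= 1]. It is the source of the decay in time. *)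
Lemma energy_le j N a b : energy j N a b <= energy j.+1 N a b.
Proof.
rewrite /energy ler_pM2l//; apply: ler_sum_nat => k /andP[k0 _].
apply: ler_wpM2r; first by rewrite addr_ge0 ?sqr_ge0.
rewrite ler_weXn2l//; last by rewrite leq_mul.
by apply: le_trans (freq_ge k); rewrite ler1n.
Qed.

(** Cauchy-Schwarz between energies, read off the nonnegative sum of
    [(freq k ^ 2 - t) ^ 2 (a k ^ 2 + b k ^ 2)] at [t = E_1 / m]. A positive bound [m] stands for
    [E_0], so that the division is legitimate. *)
Lemma energy_interpolation N a b (m : R) : 0 < m -> energy 0 N a b <= m ->
  energy 1 N a b ^+ 2 <= m * energy 2 N a b.
Proof.
move=> m0 E0m; set t := energy 1 N a b / m.
have : 0 <= energy 2 N a b + (- 2 * t) * energy 1 N a b + t ^+ 2 * energy 0 N a b.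
  rewrite /energy (mulrCA (- 2 * t)) (mulrCA (t ^+ 2)) -2!mulrDr mulr_ge0//.
  rewrite !mulr_sumr -2!big_split/=.
  rewrite sumr_ge0// => k _.
  rewrite [leRHS](_ : _ = (freq R k ^+ 2 - t) ^+ 2 * (a k ^+ 2 + b k ^+ 2)).
    by rewrite mulr_ge0 ?sqr_ge0// addr_ge0 ?sqr_ge0.
  by rewrite muln0 muln1; ring.
have : t ^+ 2 * energy 0 N a b <= t ^+ 2 * m by rewrite ler_wpM2l ?sqr_ge0.
have -> : energy 1 N a b = t * m by rewrite /t divfK ?gt_eqF.
move=> h1 h2; have : 0 <= energy 2 N a b - t ^+ 2 * m.
  by move: h1 h2; set z := t ^+ 2 * _; rewrite expr2; lra.
by move=> h3; have : 0 <= m * (energy 2 N a b - t ^+ 2 * m); [exact: mulr_ge0 (ltW _) h3|lra].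
Qed.

(** First [q ^ 2 <= a ^ 2 + b ^ 2], then [2 |q| <= s q ^ 2 + 1 / s]. The free [s] lets each
    frequency carry its own weight, which gives Cauchy-Schwarz for sums without square roots. *)
Lemma cos_sin_young (a b x s : R) : 0 < s ->
  2 * `|a * cos x + b * sin x| <= s * (a ^+ 2 + b ^+ 2) + s^-1.
Proof.
move=> s0; set q := a * _ + _.
have qab : q ^+ 2 <= a ^+ 2 + b ^+ 2.
  rewrite -subr_ge0 (_ : _ - _ = (a * sin x - b * cos x) ^+ 2) ?sqr_ge0//.
  have := cos2Dsin2 x => e.
  transitivity ((a ^+ 2 + b ^+ 2) * (cos x ^+ 2 + sin x ^+ 2) - q ^+ 2).
    by rewrite e mulr1.
  by rewrite /q; ring.
apply: (@le_trans _ _ (s * q ^+ 2 + s^-1)); last by rewrite lerD2r ler_pM2l.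
rewrite -[q ^+ 2]real_normK ?num_real// -subr_ge0.
rewrite (_ : _ - _ = s^-1 * (s * `|q| - 1) ^+ 2).
  by rewrite mulr_ge0 ?sqr_ge0// invr_ge0 ltW.
by field; rewrite gt_eqF.
Qed.

Lemma sum_inv_sqr_le (m : R) N : 0 < m ->
  \sum_(1 <= k < N.+1) (k%:R + m) ^- 2 <= m^-1.
Proof.
move=> m0; apply: (@le_trans _ _ (m^-1 - (N%:R + m)^-1)); last first.
  by rewrite gerBl invr_ge0 addr_ge0// ltW.
elim: N => [|N IH]; first by rewrite big_geq// add0r subrr.
rewrite big_nat_recr//=; have p : 0 < N%:R + m by rewrite ltr_wpDl.
rewrite -natr1; have p1 : 0 < N%:R + 1 + m by lra.
suff : (N%:R + 1 + m) ^- 2 <= (N%:R + m)^-1 - (N%:R + 1 + m)^-1 by lra.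
have -> : (N%:R + m)^-1 - (N%:R + 1 + m)^-1 = ((N%:R + m) * (N%:R + 1 + m))^-1.
  by field; rewrite !gt_eqF.
rewrite lef_pV2 ?posrE ?mulr_gt0 ?exprn_gt0// expr2 ler_pM2r//; lra.
Qed.

(* Cauchy-Schwarz against the weights [(k + m) ^ 2], whose inverses sum to at
   most [1 / m] by telescoping; optimising in [m] would give the interpolation
   inequality between the sup norm and the L^2 norms of the function and its
   derivative. *)
Lemma trigpoly_sub_mean_sqr_le N a b (x m : R) : 0 < m ->
  (trigpoly N a b x - a 0%N) ^+ 2 <=
  4 / m * (energy 1 N a b + m ^+ 2 * energy 0 N a b).
Proof.
move=> m0; set w := trigpoly N a b x - a 0%N.
have wE : w = \sum_(1 <= k < N.+1) (a k * cosk k x + b k * sink k x).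
  rewrite /w /trigpoly -(big_mkord xpredT (fun k => a k * cosk k x + b k * sink k x)).
  by rewrite big_ltn//= cosk0 sink0; ring.
pose X := \sum_(1 <= k < N.+1) (k%:R + m) ^+ 2 * (a k ^+ 2 + b k ^+ 2).
have X0 : 0 <= X.
  by rewrite sumr_ge0// => k _; rewrite mulr_ge0 ?sqr_ge0// addr_ge0 ?sqr_ge0.
have XE : X <= 4 * (energy 1 N a b + m ^+ 2 * energy 0 N a b).
  rewrite /energy mulrCA -mulrDr mulrA (_ : 4 * 2^-1 = 2); last by lra.
  rewrite mulr_sumr -big_split mulr_sumr/=; apply: ler_sum_nat => k _.
  rewrite muln0 expr0 mul1r -mulrDl mulrA ler_wpM2r ?addr_ge0 ?sqr_ge0//.
  apply: (@le_trans _ _ (2 * (k%:R ^+ 2 + m ^+ 2))).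
    rewrite -subr_ge0 (_ : _ - _ = (k%:R - m) ^+ 2) ?sqr_ge0//; ring.
  by rewrite ler_pM2l// lerD2r ler_sqr ?nnegrE ?freq_ge0// freq_ge.
apply: (@le_trans _ _ (m^-1 * X)); last first.
  by rewrite (mulrC 4) -mulrA ler_pM2l// invr_gt0.
have [->|w0] := eqVneq w 0; first by rewrite expr0n/= mulr_ge0// invr_ge0 ltW.
have {}w0 : 0 < `|w| by rewrite normr_gt0.
have key s : 0 < s -> 2 * `|w| <= s * X + (s * m)^-1.
  move=> s0; rewrite wE.
  apply: (@le_trans _ _ (\sum_(1 <= k < N.+1)
    (s * ((k%:R + m) ^+ 2 * (a k ^+ 2 + b k ^+ 2)) + s^-1 * (k%:R + m) ^- 2))).
    apply: (le_trans (ler_wpM2l _ (ler_norm_sum _ _ _))) => //.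
    rewrite mulr_sumr; apply: ler_sum => k _.
    rewrite mulrA -invfM; apply: cos_sin_young.
    by rewrite mulr_gt0// exprn_gt0// ltr_wpDl.
  rewrite big_split/= -!mulr_sumr lerD2l invfM ler_pM2l ?invr_gt0//.
  exact: sum_inv_sqr_le.
(* With this [s] the term [(s m)^-1] is [|w|] itself and can be subtracted, leaving
   [w ^ 2 <= X / m]. *)
have := key (m * `|w|)^-1; rewrite invr_gt0 mulr_gt0// => /(_ isT).
rewrite (_ : ((m * `|w|)^-1 * m)^-1 = `|w|); last by field; rewrite !gt_eqF.
move=> h; have {h} : `|w| <= (m * `|w|)^-1 * X by lra.
rewrite mulrC ler_pdivlMr ?mulr_gt0// -[w ^+ 2]real_normK ?num_real//.
rewrite expr2 ler_pdivlMl//; lra.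
Qed.

Notation dtrig N a b := (trigpoly N (fun k => freq R k * b k) (fun k => - freq R k * a k)).

Lemma mean_dtrig_sqr N a b :
  mean (fun x => dtrig N a b x ^+ 2) = energy 1 N a b.
Proof.
rewrite (eq_mean (g := fun x => dtrig N a b x * dtrig N a b x))// parseval.
rewrite /= freq0 !mul0r add0r /energy; congr (_ * _); apply: eq_bigr => k _.
by rewrite muln1; ring.
Qed.

(** Coefficients of the second derivative, left unsimplified so that they match two applications of
    [is_derive_trigpoly] by conversion. *)
Definition ddcoefc a k := freq R k * (- freq R k * a k).
Definition ddcoefs b k := - freq R k * (freq R k * b k).

Lemma mean_ddtrig_sqr N a b :
  mean (fun x => trigpoly N (ddcoefc a) (ddcoefs b) x ^+ 2) = energy 2 N a b.
Proof.
rewrite (eq_mean (g := fun x => trigpoly N (ddcoefc a) (ddcoefs b) x *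
  trigpoly N (ddcoefc a) (ddcoefs b) x))// parseval.
rewrite /ddcoefc /ddcoefs /= freq0 !mul0r add0r /energy; congr (_ * _); apply: eq_bigr => k _.
by rewrite (_ : (2 * 2)%N = 4%N)//; ring.
Qed.

Lemma is_derive_dtrig N a b (x : R) :
  is_derive x 1 (dtrig N a b) (trigpoly N (ddcoefc a) (ddcoefs b) x).
Proof. exact: is_derive_trigpoly. Qed.

Lemma continuousMr f g : continuous f -> continuous g -> continuous (fun x => f x * g x).
Proof. by move=> cf cg x; apply: cvgM; [exact: cf|exact: cg]. Qed.

(* Comes from [trigpoly_sub_mean_sqr_le] with [m = 16 (M ^ 2 + 1) / nu ^ 4]. *)
Definition cubic_const (nu M : R) : R := 128 * (M ^+ 2 + 1) ^+ 2 / nu ^+ 6.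

(** As [u_x u_xx] has mean 0, [u] may be replaced by [u - a 0], whose sup norm is controlled by the
    energies. Young's inequality then leaves [W E_1], and interpolation trades its quadratic part
    [E_1 ^ 2] for [E_2]. *)
Lemma cubic_estimate N a b (nu M : R) : 0 < nu -> energy 0 N a b <= M ^+ 2 ->
  2 * mean (fun x => trigpoly N a b x * dtrig N a b x * trigpoly N (ddcoefc a) (ddcoefs b) x)
  <= nu ^+ 2 * energy 2 N a b + cubic_const nu M * energy 1 N a b.
Proof.
move=> nu0 E0M.
set u := trigpoly N a b; set ux := dtrig N a b; set uxx := trigpoly N (ddcoefc a) (ddcoefs b).
have cu : continuous u by exact: continuous_trigpoly.
have cux : continuous ux by exact: continuous_trigpoly.
have cuxx : continuous uxx by exact: continuous_trigpoly.
pose P := nu ^+ 2; have P0 : 0 < P by rewrite exprn_gt0.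
(* The added 1 keeps [m0] positive even when [M = 0], as [energy_interpolation] requires. *)
pose m0 := M ^+ 2 + 1; have m00 : 0 < m0 by rewrite ltr_wpDl ?sqr_ge0.
(* The value 16 makes [(2 / P) (4 / m) m0] equal to [P / 2]; with the [P / 2] from Young's
   inequality the coefficient of [E_2] is then exactly [nu ^ 2], half of the available
   dissipation. *)
pose m := 16 * m0 / P ^+ 2; have mp : 0 < m by rewrite divr_gt0 ?mulr_gt0 ?exprn_gt0.
pose W := 4 / m * (energy 1 N a b + m ^+ 2 * energy 0 N a b).
have i1 : integrable01 (fun x => uxx x ^+ 2).
  by apply: continuous_integrable01; exact: continuousMr.
have i2 : integrable01 (fun x => ux x ^+ 2).
  by apply: continuous_integrable01; exact: continuousMr.
have i3 : integrable01 (fun x => ux x * uxx x).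
  by apply: continuous_integrable01; exact: continuousMr.
have i4 : integrable01 (fun x => u x * ux x * uxx x).
  by apply: continuous_integrable01; apply: continuousMr => //; exact: continuousMr.
have z0 : mean (fun x => ux x * uxx x) = 0.
  rewrite parseval /ddcoefc /ddcoefs freq0 !mul0r add0r big1 ?mulr0// => k _; ring.
have : mean (fun x => 2 * (u x * ux x * uxx x) + (-2 * a 0%N) * (ux x * uxx x)) <=
    mean (fun x => 2^-1 * P * uxx x ^+ 2 + 2 / P * W * ux x ^+ 2).
  apply: le_mean.
  - by apply: integrable01D; exact: integrable01Z.
  - by apply: integrable01D; exact: integrable01Z.
  move=> x; have wW : (u x - a 0%N) ^+ 2 <= W by exact: trigpoly_sub_mean_sqr_le.
  apply: (@le_trans _ _ (2^-1 * P * uxx x ^+ 2 + 2 / P * (u x - a 0%N) ^+ 2 * ux x ^+ 2)).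
    rewrite -subr_ge0 (_ : _ - _ = (2 * P)^-1 * (P * uxx x - 2 * (u x - a 0%N) * ux x) ^+ 2).
      by rewrite mulr_ge0 ?sqr_ge0// invr_ge0 mulr_ge0// ltW.
    by field; rewrite gt_eqF.
  by rewrite lerD2l ler_wpM2r ?sqr_ge0// ler_pM2l// divr_gt0.
rewrite !meanD; [|exact: integrable01Z..].
rewrite !meanZ// z0 mulr0 addr0 mean_ddtrig_sqr mean_dtrig_sqr => /le_trans; apply.
have E01 : energy 0 N a b <= m0 by rewrite /m0; lra.
have interp := energy_interpolation m00 E01.
have e1 := energy_ge0 1 N a b.
have WE : W * energy 1 N a b <= 4 / m * (m0 * energy 2 N a b) + 4 * m * m0 * energy 1 N a b.
  rewrite /W [leLHS](_ : _ = 4 / m * energy 1 N a b ^+ 2 +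
     4 * m * energy 0 N a b * energy 1 N a b); last by field; rewrite gt_eqF.
  apply: lerD; first by rewrite ler_pM2l// divr_gt0.
  by rewrite ler_wpM2r// ler_wpM2l// mulr_ge0// ltW.
have := ler_wpM2l (_ : 0 <= 2 / P) WE; rewrite divr_ge0 ?(ltW P0)// => /(_ isT) h.
rewrite -[2 / P * W * _]mulrA; apply: (le_trans (lerD (lexx _) h)).
rewrite le_eqVlt; apply/orP; left; apply/eqP.
rewrite /m /cubic_const -/m0 /P; field.
by rewrite !gt_eqF.
Qed.

Lemma mean_dtrig_pow4 N a b (A : R) : (forall x, `|trigpoly N a b x| <= A) ->
  mean (fun x => dtrig N a b x ^+ 4) <= 9 * A ^+ 2 * energy 2 N a b.
Proof.
move=> uA.
set u := trigpoly N a b in uA *; set ux := dtrig N a b; set uxx := trigpoly N (ddcoefc a) (ddcoefs b).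
have cu : continuous u by exact: continuous_trigpoly.
have cux : continuous ux by exact: continuous_trigpoly.
have cuxx : continuous uxx by exact: continuous_trigpoly.
have A0 : 0 <= A := le_trans (normr_ge0 _) (uA 0).
have i4 : integrable01 (fun x => ux x ^+ 4).
  by apply: continuous_integrable01; do ?[apply: continuousMr => //].
have cd : continuous (fun x => u x * (3 * ux x ^+ 2 * uxx x)).
  do ?[apply: continuousMr => //]; by move=> x; exact: cvg_cst.
have i5 := continuous_integrable01 cd.
have i1 : integrable01 (fun x => uxx x ^+ 2).
  by apply: continuous_integrable01; exact: continuousMr.
have z : mean (fun x => ux x ^+ 4 + u x * (3 * ux x ^+ 2 * uxx x)) = 0.
  apply: (@mean_derive_periodic _ (fun x => u x * ux x ^+ 3)).
  - move=> x; have d1 := is_derive_trigpoly N a b x.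
    have d2 := is_derive_dtrig N a b x.
    apply: (is_derive_eq (is_deriveM d1 (is_deriveX 3 d2))); rewrite /GRing.scale/= -/u -/ux -/uxx -mulr_natl.
    rewrite (_ : (ux ^+ 3) x = ux x ^+ 3)//; ring.
  - move=> x; apply: cvgD; last exact: cd.
    by do ?[apply: continuousMr => //].
  - by move=> x; rewrite /u /ux !trigpoly_periodic.
have : mean (fun x => 2^-1 * ux x ^+ 4) <=
  mean (fun x => (ux x ^+ 4 + u x * (3 * ux x ^+ 2 * uxx x)) + 9 / 2 * A ^+ 2 * uxx x ^+ 2).
  apply: le_mean.
  - exact: integrable01Z.
  - by apply: integrable01D; [exact: integrable01D|exact: integrable01Z].
  move=> x; have : u x ^+ 2 <= A ^+ 2.
    by rewrite -[u x ^+ 2]real_normK ?num_real// ler_sqr ?nnegrE.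
  move=> h; have : u x ^+ 2 * uxx x ^+ 2 <= A ^+ 2 * uxx x ^+ 2.
    by rewrite ler_wpM2r ?sqr_ge0.
  (* Half of this square is the pointwise inequality. Its mixed term [3 u u_x^2 u_xx] completes
     [u_x^4] to the derivative of [u u_x^3], whose mean vanishes. *)
  have : 0 <= (ux x ^+ 2 + 3 * u x * uxx x) ^+ 2 by rewrite sqr_ge0.
  rewrite (_ : (ux x ^+ 2 + _) ^+ 2 = ux x ^+ 4 + 2 * (u x * (3 * ux x ^+ 2 * uxx x)) +
    9 * (u x ^+ 2 * uxx x ^+ 2)); last by ring.
  by rewrite -!mulrA; lra.
rewrite meanD; [|exact: integrable01D|exact: integrable01Z].
rewrite z add0r !meanZ// mean_ddtrig_sqr; lra.
Qed.

(** The remainder has at most [N] frequencies, all above [N]; each is estimated by [cos_sin_young]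
    with weight [th freq ^ 2]. Keeping [th] free makes the bound linear in [E_2], so that it can be
    compared at each time with the derivative of a Lyapunov function. *)
Lemma projection_error N a b (A th : R) g x : (0 < N)%N -> 0 < th ->
  (forall x, `|trigpoly N a b x| <= A) ->
  (forall y, g y = trigpoly N a b y * dtrig N a b y) ->
  `|g x - trigpoly N (coefc g) (coefs g) x| <=
    20 * th * A ^+ 2 * energy 2 N a b + (th * N%:R)^-1.
Proof.
move=> N0 th0 uA /funext gdef.
set u := trigpoly N a b in uA; set ux := dtrig N a b; set uxx := trigpoly N (ddcoefc a) (ddcoefs b).
have cu : continuous u by exact: continuous_trigpoly.
have cux : continuous ux by exact: continuous_trigpoly.
have cuxx : continuous uxx by exact: continuous_trigpoly.
have A0 : 0 <= A := le_trans (normr_ge0 _) (uA 0).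
pose al := coefc g; pose be := coefs g.
have gE : g =1 trigpoly (N + N) al be.
  by apply: is_trigpoly_coef; rewrite gdef; exact: is_trigpolyM.
have dg (y : R) : is_derive y 1 g (ux y ^+ 2 + u y * uxx y).
  have d1 := is_derive_trigpoly N a b y.
  have d2 := is_derive_dtrig N a b y.
  rewrite gdef; apply: (is_derive_eq (is_deriveM d1 d2)).
  by rewrite /GRing.scale/= -/u -/ux -/uxx; ring.
(* Two expressions for the derivative of [g]: one from the product rule, the other from its
   expansion of degree [2 N]. *)
have dgE : (fun y => ux y ^+ 2 + u y * uxx y) =1
    trigpoly (N + N) (fun k => freq R k * be k) (fun k => - freq R k * al k).
  move=> y; have [_ <-] := dg y; have [_ <-] := is_derive_trigpoly (N + N) al be y.
  by congr ('D_1 _ y); apply/funext.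
(* Here [20 = 2 * 9 + 2]: twice the bound on the mean of [u_x^4], plus [2 A ^ 2 E_2] from
   [u u_xx]. *)
have B : energy 1 (N + N) al be <= 20 * A ^+ 2 * energy 2 N a b.
  rewrite -mean_dtrig_sqr -(eq_mean (fun y => congr1 (fun z => z ^+ 2) (dgE y))).
  have i4 : integrable01 (fun x => ux x ^+ 4).
    by apply: continuous_integrable01; do ?[apply: continuousMr => //].
  have i1 : integrable01 (fun x => uxx x ^+ 2).
    by apply: continuous_integrable01; exact: continuousMr.
  apply: (@le_trans _ _ (mean (fun y => 2 * ux y ^+ 4 + 2 * A ^+ 2 * uxx y ^+ 2))).
    apply: le_mean.
    - apply: continuous_integrable01; apply: continuousMr;
        by move=> y; apply: cvgD; apply: continuousMr.
    - by apply: integrable01D; exact: integrable01Z.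
    move=> y; have : u y ^+ 2 <= A ^+ 2.
      by rewrite -[u y ^+ 2]real_normK ?num_real// ler_sqr ?nnegrE.
    move=> h; have : u y ^+ 2 * uxx y ^+ 2 <= A ^+ 2 * uxx y ^+ 2.
      by rewrite ler_wpM2r ?sqr_ge0.
    have : 0 <= (ux y ^+ 2 - u y * uxx y) ^+ 2 by rewrite sqr_ge0.
    rewrite (_ : (_ - _) ^+ 2 = 2 * ux y ^+ 4 + 2 * (u y ^+ 2 * uxx y ^+ 2) -
       (ux y ^+ 2 + u y * uxx y) ^+ 2); last by ring.
    by rewrite -!mulrA; lra.
  rewrite meanD; [|exact: integrable01Z..].
  rewrite !meanZ// mean_ddtrig_sqr.
  have := mean_dtrig_pow4 uA; rewrite -/ux; lra.
rewrite gE.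
have -> : trigpoly (N + N) al be x - trigpoly N (coefc g) (coefs g) x =
    \sum_(N.+1 <= k < (N + N).+1) (al k * cosk k x + be k * sink k x).
  rewrite /trigpoly -2!(big_mkord xpredT (fun k => al k * cosk k x + be k * sink k x)).
  by rewrite (big_cat_nat (n := N.+1))//=; [rewrite addrAC subrr add0r|lia].
have h2 : 2 * `|\sum_(N.+1 <= k < (N + N).+1) (al k * cosk k x + be k * sink k x)| <=
    2 * (th * energy 1 (N + N) al be) + (th * N%:R)^-1.
  apply: (@le_trans _ _ (\sum_(N.+1 <= k < (N + N).+1)
    (th * (freq R k ^+ 2 * (al k ^+ 2 + be k ^+ 2)) + (th * N%:R ^+ 2)^-1))).
    apply: (le_trans (ler_wpM2l _ (ler_norm_sum _ _ _))) => //.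
    rewrite mulr_sumr; apply: ler_sum_nat => k /andP[kN _].
    have k0 : 0 < freq R k by rewrite freq_gt0//; lia.
    apply: (@le_trans _ _ (th * freq R k ^+ 2 * (al k ^+ 2 + be k ^+ 2) +
       (th * freq R k ^+ 2)^-1)).
      by apply: cos_sin_young; rewrite mulr_gt0// exprn_gt0.
    have NR0 : 0 < N%:R :> R by rewrite ltr0n.
    rewrite mulrA lerD2l lef_pV2 ?posrE;
      [|by apply: mulr_gt0 => //; exact: exprn_gt0..].
    rewrite ler_pM2l// ler_sqr ?nnegrE// ?freq_ge0//.
    by apply: le_trans (freq_ge k); rewrite ler_nat ltnW.
  rewrite big_split/= sumr_const_nat -mulr_sumr; apply: lerD.
    rewrite mulrCA ler_pM2l// /energy mulrA divff// mul1r.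
    rewrite [leRHS](big_cat_nat (n := N.+1))//=; last by lia.
    rewrite muln1 lerDr sumr_ge0// => k _.
    by rewrite mulr_ge0 ?exprn_ge0 ?freq_ge0// addr_ge0 ?sqr_ge0.
  rewrite subSS addnK -mulr_natr le_eqVlt; apply/orP; left; apply/eqP; field.
  by rewrite !gt_eqF// ltr0n.
have thN : 0 < (th * N%:R)^-1 by rewrite invr_gt0 mulr_gt0// ltr0n.
have {}B := ler_wpM2l (ltW th0) B.
have e : th * (20 * A ^+ 2 * energy 2 N a b) = 20 * th * A ^+ 2 * energy 2 N a b by ring.
by move: h2 B; rewrite e; set z := `|_|; lra.
Qed.

End energy.

(** * The maximum principle *)

Section maximum_principle.
Variable R : realType.
Implicit Types (f g F : R -> R).

Lemma is_derive_expansion f (x d e : R) : is_derive x 1 f d -> 0 < e ->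
  exists2 r, 0 < r & forall h, 0 < `|h| < r ->
    `|f (x + h) - f x - d * h| <= e * `|h|.
Proof.
move=> [df <-] e0.
have dl : (fun h : R => h^-1 *: ((f \o shift x) (h *: 1) - f x)) @ 0^' --> 'D_1 f x := df.
have [r/= r0 rP] := cvgr_dist_lt _ _ dl _ e0; exists r => // h /andP[h0 hr].
have := rP h; rewrite /= sub0r normrN => /(_ hr); rewrite -normr_gt0 => /(_ h0).
have hn0 : h != 0 by rewrite -normr_gt0.
rewrite [h *: 1]mulr1 (addrC h x) distrC => /ltW he.
rewrite (_ : _ - _ = h * (h^-1 * (f (x + h) - f x) - 'D_1 f x)); last by field.
by rewrite normrM mulrC ler_wpM2r.
Qed.

(** Only earlier points are compared, because the maximum in time may sit at the final time of the
    interval considered. *)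
Lemma left_max_derive_ge0 f (x d r : R) : is_derive x 1 f d -> 0 < r ->
  (forall y, x - r < y < x -> f y <= f x) -> 0 <= d.
Proof.
move=> df r0 fx; rewrite leNgt; apply/negP => d0.
have [|s s0 sP] := @is_derive_expansion f x d (- d / 2) df; first by lra.
pose h := Num.min r s / 2.
have m0 : 0 < Num.min r s by rewrite lt_min r0.
have mr : Num.min r s <= r by rewrite ge_min lexx.
have ms : Num.min r s <= s by rewrite ge_min lexx orbT.
have := sP (- h); rewrite normrN gtr0_norm /h; last by lra.
have -> : 0 < Num.min r s / 2 < s by apply/andP; split; lra.
move=> /(_ isT); have := fx (x - h); rewrite /h.
have -> : x - r < x - Num.min r s / 2 < x by apply/andP; split; lra.
move=> /(_ isT) fle; rewrite ler_norml => /andP[+ _].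
have : 0 < (- d) * Num.min r s by rewrite mulr_gt0// oppr_gt0.
move: fle; set A := f _; set B := f x; set z := Num.min _ _; nra.
Qed.

Lemma right_max_derive_le0 f (x d r : R) : is_derive x 1 f d -> 0 < r ->
  (forall y, x < y < x + r -> f y <= f x) -> d <= 0.
Proof.
move=> df r0 fx; rewrite leNgt; apply/negP => d0.
have [|s s0 sP] := @is_derive_expansion f x d (d / 2) df; first by lra.
pose h := Num.min r s / 2.
have m0 : 0 < Num.min r s by rewrite lt_min r0.
have mr : Num.min r s <= r by rewrite ge_min lexx.
have ms : Num.min r s <= s by rewrite ge_min lexx orbT.
have := sP h; rewrite gtr0_norm /h; last by lra.
have -> : 0 < Num.min r s / 2 < s by apply/andP; split; lra.
move=> /(_ isT); have := fx (x + h); rewrite /h.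
have -> : x < x + Num.min r s / 2 < x + r by apply/andP; split; lra.
move=> /(_ isT) fle; rewrite ler_norml => /andP[+ _].
have : 0 < d * Num.min r s by rewrite mulr_gt0.
move: fle; set A := f _; set B := f x; set z := Num.min _ _; nra.
Qed.

Lemma max_derive_eq0 f (x d : R) : is_derive x 1 f d -> (forall y, f y <= f x) ->
  d = 0.
Proof.
move=> df fx; apply/eqP; rewrite eq_le.
by rewrite (right_max_derive_le0 df ltr01)// (left_max_derive_ge0 df ltr01).
Qed.

(** At the maximum [f1] vanishes; if [d > 0] then [f1] is positive just to the right, and the mean
    value theorem yields a larger value of [f]. *)
Lemma max_derive2_le0 f f1 (x d : R) : (forall y : R, is_derive y 1 f (f1 y)) ->
  is_derive x 1 f1 d -> (forall y, f y <= f x) -> d <= 0.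
Proof.
move=> df df1 fx; have f10 : f1 x = 0 := max_derive_eq0 (df x) fx.
rewrite leNgt; apply/negP => d0.
have [|s s0 sP] := @is_derive_expansion f1 x d (d / 2) df1; first by lra.
have [//||c] := @MVT _ f f1 x (x + s / 2).
- by rewrite ltrDl divr_gt0.
- by apply: continuous_subspaceT; exact: is_derive_continuous df.
rewrite in_itv/= => /andP[xc cs] /esym.
have cx0 : 0 < c - x by rewrite subr_gt0.
have := sP (c - x); rewrite (gtr0_norm cx0).
have -> : 0 < c - x < s by apply/andP; split; lra.
move=> /(_ isT); rewrite (addrC x) subrK f10 subr0 ler_norml => /andP[h _].
have := fx (x + s / 2); rewrite -subr_le0 => h2 h1.
have dcx : 0 < d * (c - x) by rewrite mulr_gt0.
have f1c : 0 < f1 c by move: h dcx; set z := c - x; lra.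
have : 0 < f1 c * (x + s / 2 - x) by rewrite mulr_gt0//; lra.
by rewrite h1; lra.
Qed.

Lemma within_continuousP (T U : topologicalType) (A : set T) (f : T -> U) :
  {within A, continuous f} <-> forall x, A x -> f y @[y --> within A (nbhs x)] --> f x.
Proof. exact: subspace_continuousP. Qed.

Lemma cvg_within_fst (T : topologicalType) (a : R -> T) (p : R * R) :
  {within [set t : R | 0 <= t], continuous a} -> 0 <= p.1 ->
  a q.1 @[q --> within [set q : R * R | 0 <= q.1] (nbhs p)] --> a p.1.
Proof.
move=> /within_continuousP ca p0.
apply: cvg_trans (ca _ p0) => B /= PB.
exact: (@cvg_fst _ _ (nbhs p.1) (nbhs p.2) _ _ PB).
Qed.

(** If the bound fails, the ratio [|v| / Phi] has a maximum [m > 1] on a compact time slab, at some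
    positive time. There [m Phi] touches [|v|] from above, so the derivative of [|v|] is at least
    [m Phi']. The strict hypothesis, a comparison of logarithmic derivatives cleared of
    denominators, forbids this. *)
Lemma parabolic_comparison (v : R -> R -> R) (Phi : R -> R) :
  (forall t : R, 0 <= t -> periodic (v t) 1) ->
  {within [set p : R * R | 0 <= p.1], continuous (fun p => v p.1 p.2)} ->
  {within [set t : R | 0 <= t], continuous Phi} ->
  (forall t : R, 0 <= t -> 0 < Phi t) ->
  (forall t x : R, 0 < t -> derivable (v ^~ x) t 1) ->
  (forall t : R, 0 < t -> derivable Phi t 1) ->
  (forall x : R, `|v 0 x| <= Phi 0) ->
  (forall t x : R, 0 < t -> (forall y, `|v t y| <= `|v t x|) -> Phi t <= `|v t x| ->
    Num.sg (v t x) * derive1 (v ^~ x) t * Phi t < `|v t x| * derive1 Phi t) ->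
  forall t x : R, 0 <= t -> `|v t x| <= Phi t.
Proof.
move=> vper vc Pc P0 dv dP v0 key T x1 T0.
rewrite leNgt; apply/negP => ltPv.
pose K : set (R * R) := `[0, T] `*` `[0, 1].
have cK : compact K by apply: compact_setX; exact: segment_compact.
have K0 p : K p -> 0 <= p.1 by move=> [/=]; rewrite in_itv/= => /andP[].
pose h (p : R * R) := `|v p.1 p.2| / Phi p.1.
have ch : {within K, continuous h}.
  apply: (@continuous_subspaceW _ _ _ [set p : R * R | 0 <= p.1]); first exact: K0.
  apply/within_continuousP => p /= p0; apply: cvgM.
    by apply: cvg_norm; exact: ((within_continuousP _ _).1 vc).
  apply: cvgV; first by rewrite gt_eqF// P0.
  exact: cvg_within_fst.
have [y1 /andP[y10 y11] vy1] := periodic_itv x1 (vper T T0).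
have KT : K (T, y1) by split; rewrite /= in_itv/= ?lexx ?andbT//; apply/andP; split => //; exact: ltW.
have [[t x] /set_mem Kp hmax] := compact_EVT_max (ex_intro _ _ KT) cK ch.
have t0 : 0 <= t := K0 _ Kp.
have [tT x01] : (0 <= t <= T) /\ (0 <= x <= 1).
  by case: Kp; rewrite /= !in_itv/=.
pose m := h (t, x).
have m1 : 1 < m.
  apply: (@lt_le_trans _ _ (h (T, y1))); last by apply: hmax; exact: mem_set.
  by rewrite /h/= ltr_pdivlMr ?P0// mul1r vy1.
have hm s y : 0 <= s <= T -> `|v s y| <= m * Phi s.
  move=> sT; have s0 : 0 <= s by case/andP: sT.
  have [z /andP[z0 z1] <-] := periodic_itv y (vper s s0).
  rewrite -ler_pdivrMr ?P0//; apply: (hmax (s, z)); apply: mem_set.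
  by split; rewrite /= in_itv//= z0 ltW.
have vE : `|v t x| = m * Phi t by rewrite /m /h/= divfK// gt_eqF// P0.
have tp : 0 < t.
  rewrite lt_neqAle t0 andbT eq_sym; apply/eqP => tz.
  move: vE (v0 x); rewrite tz => ->; rewrite leNgt => /negP; apply.
  by rewrite ltr_pMl// P0.
have P0t := P0 t t0.
have := key t x tp; rewrite vE => /(_ _ _)/wrap[||].
  by move=> y; apply: hm; case/andP: tT => _ ->; rewrite andbT.
by rewrite ler_peMl ?ltW.
apply/negP; rewrite -leNgt mulrAC ler_pM2r//.
have d1 : is_derive t 1 (v ^~ x) (derive1 (v ^~ x) t).
  by rewrite derive1E; apply: DeriveDef => //; exact: dv.
have d2 : is_derive t 1 Phi (derive1 Phi t).
  by rewrite derive1E; apply: DeriveDef => //; exact: dP.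
rewrite -subr_ge0.
(* The sign is frozen at its value at [(t, x)]: [sg * v] is differentiable in time, lies below
   [|v|], and equals it at the maximum. *)
have d3 := is_deriveB (is_deriveZ (Num.sg (v t x)) d1) (is_deriveZ m d2).
apply: (left_max_derive_ge0 d3 tp) => s; rewrite subrr => /andP[s0 st].
change (Num.sg (v t x) * v s x - m * Phi s <= Num.sg (v t x) * v t x - m * Phi t).
rewrite -normrEsg vE subrr subr_le0.
apply: le_trans (hm s x _); last by rewrite !ltW//=; apply: (lt_le_trans st); case/andP: tT.
apply: (le_trans (ler_norm _)); rewrite normrM ler_piMl// normr_sg.
by case: eqP.
Qed.
End maximum_principle.

(** * Fourier coefficients of the solution *)

Section coefficients_of_solution.
Variable R : realType.
Implicit Types (f g F : R -> R).

Lemma continuous_comp_within (S T U : topologicalType) (A : set T) (f : T -> U)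
    (phi : S -> T) : continuous phi -> (forall s, A (phi s)) ->
  {within A, continuous f} -> continuous (f \o phi).
Proof.
move=> cphi Aphi /within_continuousP cf s.
apply: cvg_trans (cf _ (Aphi s)) => B /= PB.
apply: (@filterS _ (nbhs s) _ _ _ _ (cphi s _ PB)) => r /= h.
exact: h (Aphi r).
Qed.

Lemma compact_norm_bounded (T : topologicalType) (A : set T) (f : T -> R) :
  compact A -> {within A, continuous f} ->
  exists2 C, 0 <= C & forall x, A x -> `|f x| <= C.
Proof.
move=> cA /within_continuousP cf.
have [A0|/set0P A0] := eqVneq A set0; first by exists 0 => // x; rewrite A0.
have [|c _ cP] := @compact_EVT_max T R (fun x => `|f x|) A A0 cA.
  by apply/(within_continuousP A (fun x => `|f x|)) => x Ax; apply: cvg_norm; exact: cf.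
by exists `|f c| => [|x Ax]; [exact: normr_ge0|apply: cP; exact: mem_set].
Qed.

Lemma continuous_pairl (t : R) : continuous (fun x : R => (t, x)).
Proof. by move=> x; exact: (cvg_pair (cvg_cst t) cvg_id). Qed.

Lemma continuous_pairr (x : R) : continuous (fun t : R => (t, x)).
Proof. by move=> t; exact: (cvg_pair cvg_id (cvg_cst x)). Qed.

Lemma continuous_pairl_comp (f : R * R -> R) (t : R) : continuous f ->
  continuous (fun x => f (t, x)).
Proof.
move=> cf x; apply: (@cvg_comp _ _ _ (fun x => (t, x)) f _ (nbhs (t, x))).
  exact: continuous_pairl.
exact: cf.
Qed.

Lemma continuous_pairr_comp (f : R * R -> R) (x : R) : continuous f ->
  continuous (fun t => f (t, x)).
Proof.
move=> cf t; apply: (@cvg_comp _ _ _ (fun t => (t, x)) f _ (nbhs (t, x))).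
  exact: continuous_pairr.
exact: cf.
Qed.

Lemma continuous_mean_param (v : R -> R -> R) g :
  {within [set p : R * R | 0 <= p.1], continuous (fun p => v p.1 p.2)} ->
  continuous g ->
  {within [set t : R | 0 <= t], continuous (fun t => mean (fun x => v t x * g x))}.
Proof.
(* Freezing [v] at its initial value for negative times makes it continuous on the whole plane, so
   continuity under the integral on an open time interval also covers [t = 0]. *)
move=> cv cg; pose w (t x : R) := v (Num.max 0 t) x.
have cw : continuous (fun p : R * R => w p.1 p.2).
  apply: (@continuous_comp_within _ _ _ _ (fun p => v p.1 p.2)
     (fun p : R * R => (Num.max 0 p.1, p.2))) cv.
  - move=> p; have c0 : {for p.1, continuous (fun s : R => Num.max 0 s)}.
      by apply: (@continuous_max _ _ (cst 0) id); [exact: cvg_cst|exact: cvg_id].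
    have c1 : (fun q : R * R => Num.max 0 q.1) @ p --> Num.max 0 p.1.
      by apply: (@cvg_comp _ _ _ fst (fun s => Num.max 0 s) _ (nbhs p.1));
        [exact: cvg_fst|exact: c0].
    have c2 : snd @ p --> p.2 by exact: cvg_snd.
    exact: (cvg_pair c1 c2).
  - by move=> p /=; rewrite le_max lexx.
suff cF : continuous (fun t => mean (fun x => w t x * g x)).
  apply: (@subspace_eq_continuous _ _ _ (fun t => mean (fun x => w t x * g x))).
    by move=> t; rewrite inE/= => t0; apply: eq_mean => x; rewrite /w max_r.
  exact: continuous_subspaceT.
move=> t; pose K : set (R * R) := `[t - 1, t + 1] `*` `[0, 1].
have cK : compact K by apply: compact_setX; exact: segment_compact.
have cwg : continuous (fun p : R * R => w p.1 p.2 * g p.2).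
  move=> p; apply: cvgM; first exact: cw.
  apply: (@cvg_comp _ _ _ snd g _ (nbhs p.2)); [exact: cvg_snd|exact: cg].
have [C C0 CP] := compact_norm_bounded cK (continuous_subspaceT cwg).
apply: (@continuity_under_integral R _ _ (@lebesgue_measure R)
  (fun s x => w s x * g x) `[0%R, 1%R] (measurable_itv _) (t - 1) (t + 1) _ _ (fun=> C)).
- move=> s _; apply: continuous_integrable01.
  exact: (continuous_pairl_comp (t := s) cwg).
- apply: aeW => x _ s _; apply: cvgM; last exact: cvg_cst.
  exact: (continuous_pairr_comp (x := x) cw).
- by apply: continuous_integrable01 => x; exact: cvg_cst.
- move=> s; rewrite /= in_itv/= => /andP[s1 s2]; apply: aeW => x x01.
  by apply: (CP (s, x)); split => //=; rewrite in_itv/= !ltW.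
- by rewrite inE/= in_itv/=; apply/andP; split; lra.
Qed.

Lemma is_derive_mean_param (v : R -> R -> R) g (t : R) :
  (forall s : R, 0 < s -> continuous (v s)) ->
  (forall s x : R, 0 < s -> derivable (v ^~ x) s 1) ->
  {within [set p : R * R | 0 < p.1], continuous (fun p => derive1 (v ^~ p.2) p.1)} ->
  continuous g -> 0 < t ->
  is_derive t 1 (fun s => mean (fun x => v s x * g x))
    (mean (fun x => derive1 (v ^~ x) t * g x)).
Proof.
move=> cv dv cdv cg t0.
(* A compact time window away from 0, where the time derivative is continuous and hence dominated by
   a constant. *)
pose K : set (R * R) := `[t / 2, 2 * t] `*` `[0, 1].
have cK : compact K by apply: compact_setX; exact: segment_compact.
have K0 : K `<=` [set p | 0 < p.1].
  by move=> p [/=]; rewrite in_itv/= => /andP[h _] _; apply: lt_le_trans h; lra.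
have cvg : {within K, continuous (fun p => derive1 (v ^~ p.2) p.1 * g p.2)}.
  have /within_continuousP c1 := continuous_subspaceW K0 cdv.
  apply/within_continuousP => p Kp; apply: cvgM; first exact: c1.
  apply: cvg_within_filter.
  by apply: (@cvg_comp _ _ _ snd g _ (nbhs p.2)); [exact: cvg_snd|exact: cg].
have [C C0 CP] := compact_norm_bounded cK cvg.
have pE (s x : R) : 0 < s -> is_derive s 1 (fun r => v r x * g x) (derive1 (v ^~ x) s * g x).
  move=> s0; have d1 : is_derive s 1 (v ^~ x) (derive1 (v ^~ x) s).
    by rewrite derive1E; apply: DeriveDef => //; exact: dv.
  apply: (is_derive_eq (is_deriveM d1 (is_derive_cst (g x) s 1))).
  by rewrite /GRing.scale/= mulr0 add0r mulrC.
have I0 (s : R) : `]t / 2, 2 * t[%classic s -> 0 < s.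
  by rewrite /= in_itv/= => /andP[h _]; apply: lt_trans h; lra.
have It : `]t / 2, 2 * t[%classic t by rewrite /= in_itv/=; apply/andP; split; lra.
have intf (s : R) : `]t / 2, 2 * t[%classic s ->
    (@lebesgue_measure R).-integrable `[0%R, 1%R] (EFin \o (fun x => v s x * g x)).
  by move=> /I0 s0; apply: continuous_integrable01; apply: continuousMr => //; exact: cv.
have der (s x : R) : `]t / 2, 2 * t[%classic s -> `[0%R, 1%R]%classic x -> derivable (fun r => v r x * g x) s 1.
  by move=> /I0 s0 _; have [] := pE s x s0.
have intC : (@lebesgue_measure R).-integrable `[0%R, 1%R] (EFin \o (fun=> C)).
  by apply: continuous_integrable01 => x; exact: cvg_cst.
have bnd (s x : R) : `]t / 2, 2 * t[%classic s -> `[0%R, 1%R]%classic x ->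
    `|partial1of2 (fun s x => v s x * g x) s x| <= C.
  move=> Is x01; rewrite partial1of2E; have [_ ->] := pE s x (I0 _ Is).
  apply: (CP (s, x)); split => //=; move: Is; rewrite /= !in_itv/= => /andP[? ?].
  by rewrite !ltW.
have C0' (y : R) : 0 <= C by [].
have h1 := derivable_under_integral (mu := @lebesgue_measure R) (measurable_itv _) It intf der C0' intC bnd.
have h2 := differentiation_under_integral (mu := @lebesgue_measure R) (measurable_itv _) It intf der C0' intC bnd.
apply: DeriveDef; first exact: h1.
rewrite -derive1E h2; apply: eq_mean => x.
by have := partial1of2E (fun s x => v s x * g x) t x => ->; have [_ ->] := pE t x t0.
Qed.

End coefficients_of_solution.

(** * The equations for the coefficients, and the absence of frequencies above [N] *)

Section coefficient_equations.
Variable R : realType.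
Implicit Types (f g F : R -> R) (k n N : nat).

Lemma derive_periodic f f1 : periodic f 1 -> (forall x : R, is_derive x 1 f (f1 x)) ->
  periodic f1 1.
Proof.
move=> pf df x; have dsh : is_derive x 1 (fun y : R => y + 1) 1.
  by apply: (is_derive_eq (is_deriveD (is_derive_id x 1) (is_derive_cst (1 : R) x 1)));
    rewrite addr0.
have d1 := is_derive1_comp (g := fun y => y + 1) (df (x + 1)) dsh.
have : f \o (fun y => y + 1) = f by apply/funext => y /=; exact: pf.
move: d1 => /[swap] -> [_]; have [_ ->] := df x.
by rewrite mulr1.
Qed.

Lemma coef_derive f f1 k : periodic f 1 -> (forall x : R, is_derive x 1 f (f1 x)) ->
  continuous f1 -> coefc f1 k = freq R k * coefs f k /\ coefs f1 k = - freq R k * coefc f k.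
Proof.
move=> pf df cf1; have cf := is_derive_continuous df.
have cc := @continuous_cosk R k; have cs := @continuous_sink R k.
have i1 : integrable01 (fun x => f1 x * cosk k x).
  by apply: continuous_integrable01; exact: continuousMr.
have i2 : integrable01 (fun x => f1 x * sink k x).
  by apply: continuous_integrable01; exact: continuousMr.
have i3 : integrable01 (fun x => f x * cosk k x).
  by apply: continuous_integrable01; exact: continuousMr.
have i4 : integrable01 (fun x => f x * sink k x).
  by apply: continuous_integrable01; exact: continuousMr.
have z1 : mean (fun x => f1 x * cosk k x + - freq R k * (f x * sink k x)) = 0.
  apply: (@mean_derive_periodic _ (fun x => f x * cosk k x)).
  - move=> x; apply: (is_derive_eq (is_deriveM (df x) (is_derive_cosk k x))).
    by rewrite /GRing.scale/=; ring.
  - move=> x; apply: cvgD; first exact: continuousMr.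
    by apply: cvgM; [exact: cvg_cst|exact: continuousMr].
  - by move=> x; rewrite pf cosk_periodic.
have z2 : mean (fun x => f1 x * sink k x + freq R k * (f x * cosk k x)) = 0.
  apply: (@mean_derive_periodic _ (fun x => f x * sink k x)).
  - move=> x; apply: (is_derive_eq (is_deriveM (df x) (is_derive_sink k x))).
    by rewrite /GRing.scale/=; ring.
  - move=> x; apply: cvgD; first exact: continuousMr.
    by apply: cvgM; [exact: cvg_cst|exact: continuousMr].
  - by move=> x; rewrite pf sink_periodic.
move: z1 z2; rewrite !meanD//; [|exact: integrable01Z..].
rewrite !meanZ// => z1 z2; rewrite /coefc /coefs.
by split; rewrite mulrCA -1?[RHS]mulrA; congr (_ * _); lra.
Qed.

Lemma coef_linear f g (s r : R) k : continuous f -> continuous g ->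
  coefc (fun x => s * f x + r * g x) k = s * coefc f k + r * coefc g k /\
  coefs (fun x => s * f x + r * g x) k = s * coefs f k + r * coefs g k.
Proof.
move=> cf cg; have [fc fs] := continuous_integrable_coefs cf k.
have [gc gs] := continuous_integrable_coefs cg k.
rewrite /coefc /coefs; split.
  rewrite (eq_mean (g := fun x => s * (f x * cosk k x) + r * (g x * cosk k x))).
    by rewrite meanD ?meanZ//; [ring|exact: integrable01Z..].
  by move=> x; ring.
rewrite (eq_mean (g := fun x => s * (f x * sink k x) + r * (g x * sink k x))).
  by rewrite meanD ?meanZ//; [ring|exact: integrable01Z..].
by move=> x; ring.
Qed.

Lemma is_derive_trigpoly_coef N (a b : R -> nat -> R) (a' b' : nat -> R) (t x : R) :
  (forall k, (k <= N)%N -> is_derive t 1 (a ^~ k) (a' k)) ->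
  (forall k, (k <= N)%N -> is_derive t 1 (b ^~ k) (b' k)) ->
  is_derive t 1 (fun s => trigpoly N (a s) (b s) x) (trigpoly N a' b' x).
Proof.
move=> da db; rewrite (_ : (fun s => _) =
  \sum_(k < N.+1) (fun s => a s k * cosk k x + b s k * sink k x)); last first.
  by apply/funext => y; rewrite fct_sumE.
apply: is_derive_sum => k; have kN : (k <= N)%N by rewrite -ltnS.
have h1 := is_deriveM (da k kN) (is_derive_cst (cosk k x) t 1).
have h2 := is_deriveM (db k kN) (is_derive_cst (sink k x) t 1).
apply: (is_derive_eq (is_deriveD h1 h2)).
by rewrite /GRing.scale/=; ring.
Qed.

Variables (nu : R) (N : nat) (u0 : R -> R) (u : R -> R -> R).
Hypotheses (nu_gt0 : 0 < nu) (sol : galerkin_solution nu N u0 u).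

Local Notation ux t := (derive1 (u t)).
Local Notation uxx t := (derive1 (derive1 (u t))).
Local Notation ut t := (fun x => derive1 (u ^~ x) t).
Local Notation g t := (fun y => u t y * derive1 (u t) y).

Lemma sol_is_derive_x (t x : R) : 0 < t -> is_derive x 1 (u t) (ux t x).
Proof.
by move=> t0; rewrite derive1E; apply: DeriveDef => //; exact: (sol_derivable_x sol).
Qed.

Lemma sol_is_derive_xx (t x : R) : 0 < t -> is_derive x 1 (ux t) (uxx t x).
Proof.
by move=> t0; rewrite [uxx t x]derive1E; apply: DeriveDef => //; exact: (sol_derivable_xx sol).
Qed.

Lemma sol_slice (t : R) : 0 < t -> [/\ continuous (u t), continuous (ux t),
  continuous (uxx t) & continuous (ut t)].
Proof.
move=> t0; split.
- exact: is_derive_continuous (fun x => sol_is_derive_x x t0).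
- exact: is_derive_continuous (fun x => sol_is_derive_xx x t0).
- exact: (continuous_comp_within (@continuous_pairl R t) (fun=> t0) (sol_continuous_xx sol)).
- exact: (continuous_comp_within (@continuous_pairl R t) (fun=> t0) (sol_continuous_t sol)).
Qed.

Lemma sol_coef_uxx (t : R) k : 0 < t ->
  coefc (uxx t) k = - freq R k ^+ 2 * coefc (u t) k /\
  coefs (uxx t) k = - freq R k ^+ 2 * coefs (u t) k.
Proof.
move=> t0; have [cu cux cuxx _] := sol_slice t0.
have pu := sol_periodic sol (ltW t0).
have dx x := sol_is_derive_x x t0; have dxx x := sol_is_derive_xx x t0.
have pux := derive_periodic pu dx.
have [-> ->] := coef_derive k pux dxx cuxx.
have [-> ->] := coef_derive k pu dx cux.
by split; ring.
Qed.

Lemma coef_fourier_proj f k : (k <= N)%N ->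
  coefc (fourier_proj N f) k = coefc f k /\ coefs (fourier_proj N f) k = coefs f k.
Proof.
move=> kN; have -> : fourier_proj N f = trigpoly N (coefc f) (coefs f).
  by apply/funext; exact: fourier_proj_trigpoly.
rewrite coefc_trigpoly coefs_trigpoly kN andbT; split=> //.
case: posnP => // ->; rewrite /coefs (eq_mean (g := fun=> 0)) ?mean_cst ?mulr0// => x.
by rewrite sink0 mulr0.
Qed.

Lemma continuous_fourier_proj n f : continuous (fourier_proj n f).
Proof.
rewrite (_ : fourier_proj n f = trigpoly n (coefc f) (coefs f)).
  exact: continuous_trigpoly.
by apply/funext; exact: fourier_proj_trigpoly.
Qed.

(** The coefficient equation for [k <= N]: the projection does not alter these modes, so the
    nonlinearity appears unprojected. *)
Definition dtcoefc (t : R) k : R := - coefc (g t) k - nu ^+ 2 * freq R k ^+ 2 * coefc (u t) k.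
Definition dtcoefs (t : R) k : R := - coefs (g t) k - nu ^+ 2 * freq R k ^+ 2 * coefs (u t) k.

Lemma sol_coef_ut (t : R) k : 0 < t -> (k <= N)%N ->
  coefc (ut t) k = dtcoefc t k /\ coefs (ut t) k = dtcoefs t k.
Proof.
move=> t0 kN; have [cu cux cuxx _] := sol_slice t0.
have -> : ut t = fun x => -1 * fourier_proj N (g t) x + nu ^+ 2 * uxx t x.
  by apply/funext => x; rewrite -(sol_equation sol x t0); ring.
have [-> ->] := coef_linear (-1) (nu ^+ 2) k (continuous_fourier_proj (n := N) (f := g t)) cuxx.
have [-> ->] := coef_fourier_proj (g t) kN.
have [-> ->] := sol_coef_uxx k t0.
by rewrite /dtcoefc /dtcoefs; split; ring.
Qed.

Lemma is_derive_sol_coef (t : R) k : 0 < t -> (k <= N)%N ->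
  is_derive t 1 (fun s => coefc (u s) k) (dtcoefc t k) /\
  is_derive t 1 (fun s => coefs (u s) k) (dtcoefs t k).
Proof.
move=> t0 kN; have [<- <-] := sol_coef_ut t0 kN.
have cu s : 0 < s -> continuous (u s) by move=> s0; have [] := sol_slice s0.
have h := fun g cg => is_derive_mean_param (g := g) cu (sol_derivable_t sol)
  (sol_continuous_t sol) cg t0.
split.
  exact: (is_deriveZ (weight R k) (h _ (@continuous_cosk R k))).
exact: (is_deriveZ (weight R k) (h _ (@continuous_sink R k))).
Qed.

Lemma continuous_sol_coef k :
  {within [set t : R | 0 <= t], continuous (fun t => coefc (u t) k)} /\
  {within [set t : R | 0 <= t], continuous (fun t => coefs (u t) k)}.
Proof.
have h := fun g cg => (within_continuousP _ _).1
  (continuous_mean_param (g := g) (sol_continuous sol) cg).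
split; apply/within_continuousP => t t0; apply: cvgM; try exact: cvg_cst.
  exact: (h _ (@continuous_cosk R k)).
exact: (h _ (@continuous_sink R k)).
Qed.

(** The notion of solution projects only the nonlinearity and the datum, so this must be proved
    before the finite sums over [k <= N] can describe [u]. *)
Lemma sol_is_trigpoly (t x : R) : u0 = fourier_proj N u0 -> 0 <= t ->
  u t x = trigpoly N (coefc (u t)) (coefs (u t)) x.
Proof.
move=> u0P t0.
(* [u] minus its projection solves the heat equation with zero initial datum. *)
pose p s := trigpoly N (coefc (u s)) (coefs (u s)).
pose v s y := u s y - p s y.
suff vE e : 0 < e -> `|v t x| <= e * (1 + t).
  apply/eqP; rewrite -subr_eq0 -normr_le0; apply/ler_addgt0Pl => e e0; rewrite addr0.
  have t1 : 0 < 1 + t by lra.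
  have := vE (e / (1 + t)); rewrite divr_gt0// divfK ?gt_eqF//; exact.
(* The barrier has slope [e > 0] because the comparison needs a strict inequality, while the heat
   equation gives only [sg * v_t <= 0] at a maximum; [e] is arbitrary. *)
move=> e0; pose Phi s := e * (1 + s).
have dPhi (s : R) : is_derive s 1 Phi e.
  have h := is_deriveZ e (is_deriveD (is_derive_cst (1 : R) s 1) (is_derive_id s 1)).
  by apply: (is_derive_eq h); rewrite /GRing.scale/= add0r mulr1.
have dp (s y : R) : 0 < s -> is_derive s 1 (fun r => p r y) (trigpoly N (dtcoefc s) (dtcoefs s) y).
  by move=> s0; apply: is_derive_trigpoly_coef => k kN; have [] := is_derive_sol_coef s0 kN.
have dv (s y : R) : 0 < s -> is_derive s 1 (v ^~ y)
    (nu ^+ 2 * (uxx s y - trigpoly N (ddcoefc (coefc (u s))) (ddcoefs (coefs (u s))) y)).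
  move=> s0; have d1 : is_derive s 1 (u ^~ y) (ut s y).
    by rewrite derive1E; apply: DeriveDef => //; exact: (sol_derivable_t sol).
  apply: (is_derive_eq (is_deriveB d1 (dp s y s0))).
  have := sol_equation sol y s0; rewrite fourier_proj_trigpoly => eqn.
  rewrite mulrBr -eqn.
  have -> : trigpoly N (dtcoefc s) (dtcoefs s) y =
      -1 * trigpoly N (coefc (g s)) (coefs (g s)) y +
      nu ^+ 2 * trigpoly N (ddcoefc (coefc (u s))) (ddcoefs (coefs (u s))) y.
    rewrite !trigpolyZ trigpolyD; apply: eq_bigr => k _.
    by rewrite /dtcoefc /dtcoefs /ddcoefc /ddcoefs; ring.
  by ring.
have dvx (s y : R) : 0 < s -> is_derive y 1 (v s) (ux s y - trigpoly N
    (fun k => freq R k * coefs (u s) k) (fun k => - freq R k * coefc (u s) k) y).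
  by move=> s0; exact: is_deriveB (sol_is_derive_x y s0) (is_derive_trigpoly N _ _ y).
have dvxx (s y : R) : 0 < s -> is_derive y 1 (fun z => ux s z - trigpoly N
    (fun k => freq R k * coefs (u s) k) (fun k => - freq R k * coefc (u s) k) z)
    (uxx s y - trigpoly N (ddcoefc (coefc (u s))) (ddcoefs (coefs (u s))) y).
  by move=> s0; exact: is_deriveB (sol_is_derive_xx y s0) (is_derive_trigpoly N _ _ y).
apply: (@parabolic_comparison R v Phi) => //.
- by move=> s s0 y; rewrite /v (sol_periodic sol) // /p trigpoly_periodic.
- apply/within_continuousP => q q0; apply: cvgB.
    exact: ((within_continuousP _ _).1 (sol_continuous sol)).
  apply: cvg_big => [|k _]; first exact: add_continuous.
  have [cc cs] := continuous_sol_coef k.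
  have csnd (h : R -> R) : continuous h ->
      h r.2 @[r --> within [set r : R * R | 0 <= r.1] (nbhs q)] --> h q.2.
    move=> ch; apply: cvg_within_filter.
    by apply: (@cvg_comp _ _ _ snd h _ (nbhs q.2)); [exact: cvg_snd|exact: ch].
  apply: cvgD; apply: cvgM.
  - exact: (cvg_within_fst cc).
  - exact: (csnd _ (@continuous_cosk R k)).
  - exact: (cvg_within_fst cs).
  - exact: (csnd _ (@continuous_sink R k)).
- apply: continuous_subspaceT; exact: is_derive_continuous dPhi.
- by move=> s s0; rewrite mulr_gt0//; lra.
- by move=> s y s0; have [] := dv s y s0.
- move=> y; rewrite /v /p (sol_initial sol) -fourier_proj_trigpoly -u0P subrr normr0.
  by rewrite /Phi addr0 mulr1 ltW.
move=> s y s0 ymax Phiv.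
have [_ dvE] := dv s y s0; rewrite !derive1E dvE; have [_ ->] := dPhi s.
have Phi0 : 0 < Phi s by rewrite mulr_gt0//; lra.
have vp : 0 < `|v s y| by exact: lt_le_trans Phiv.
apply: (@le_lt_trans _ _ 0); last by rewrite mulr_gt0.
rewrite pmulr_lle0// mulrCA pmulr_rle0 ?exprn_gt0//.
apply: (@max_derive2_le0 R (fun z => Num.sg (v s y) * v s z)
  (fun z => Num.sg (v s y) * (ux s z - trigpoly N
    (fun k => freq R k * coefs (u s) k) (fun k => - freq R k * coefc (u s) k) z)) y).
- by move=> z; exact: is_deriveZ (dvx s z s0).
- exact: is_deriveZ (dvxx s y s0).
move=> z; rewrite -normrEsg; apply: le_trans (ymax z).
apply: (le_trans (ler_norm _)); rewrite normrM ler_piMl// normr_sg.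
by case: eqP.
Qed.

End coefficient_equations.

(** * Evolution of the energies *)

Section energy_evolution.
Variable R : realType.
Implicit Types (f g F : R -> R) (k n : nat).

Lemma fourier_proj_idem n f : fourier_proj n (fourier_proj n f) = fourier_proj n f.
Proof.
apply/funext => x; rewrite 2!fourier_proj_trigpoly; apply: eq_bigr => k _.
have kn : (k <= n)%N by rewrite -ltnS.
by have [-> ->] := coef_fourier_proj f kn.
Qed.

Lemma is_derive_weighted_sqr (a b : R -> R) (t a' b' w : R) :
  is_derive t 1 a a' -> is_derive t 1 b b' ->
  is_derive t 1 (fun s => w * (a s ^+ 2 + b s ^+ 2)) (w * (2 * (a t * a') + 2 * (b t * b'))).
Proof.
move=> da db.
have h := is_deriveZ w (is_deriveD (is_deriveX 2 da) (is_deriveX 2 db)).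
by apply: (is_derive_eq h); rewrite /GRing.scale/= !expr1; ring.
Qed.

Variables (nu : R) (N : nat) (f : R -> R) (M : R) (u : R -> R -> R).
Hypotheses (nu_gt0 : 0 < nu) (N_gt0 : (0 < N)%N).
Hypotheses (fL : Linfty_torus f) (fM : Linfty_norm f = M%:E).
Hypothesis sol : galerkin_solution nu N (fourier_proj N f) u.

Local Notation ac t := (coefc (u t)).
Local Notation bs t := (coefs (u t)).
Local Notation E j t := (energy j N (ac t) (bs t)).
Local Notation g t := (fun y => u t y * derive1 (u t) y).
Local Notation utrig t := (trigpoly N (ac t) (bs t)).
Local Notation uxtrig t := (trigpoly N (fun k => freq R k * bs t k) (fun k => - freq R k * ac t k)).
Local Notation uxxtrig t := (trigpoly N (ddcoefc (ac t)) (ddcoefs (bs t))).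

Lemma sol_trigpoly (t : R) : 0 <= t -> u t = utrig t.
Proof.
move=> t0; apply/funext => x; apply: (sol_is_trigpoly nu_gt0 sol) => //.
by rewrite fourier_proj_idem.
Qed.

Lemma sol_x_trigpoly (t : R) : 0 <= t -> derive1 (u t) = uxtrig t.
Proof.
move=> t0; rewrite {1}(sol_trigpoly t0); apply/funext => x; rewrite derive1E.
by have [_ ->] := is_derive_trigpoly N (ac t) (bs t) x.
Qed.

Lemma sol_g_trigpoly (t : R) : 0 <= t -> g t = fun y => utrig t y * uxtrig t y.
Proof.
by move=> t0; apply/funext => y; rewrite -(sol_x_trigpoly t0) -(sol_trigpoly t0).
Qed.

Lemma sol_gE (t x : R) : 0 <= t ->
  u t x * derive1 (u t) x = utrig t x * uxtrig t x.
Proof. by move=> t0; have := congr1 (fun h : R -> R => h x) (sol_g_trigpoly t0). Qed.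

Lemma continuous_sol_g (t : R) : 0 <= t -> continuous (g t).
Proof.
by move=> t0; rewrite sol_g_trigpoly//; apply: continuousMr; exact: continuous_trigpoly.
Qed.

Lemma is_derive_energy j (t : R) : 0 < t -> is_derive t 1 (fun s => E j s)
  (\sum_(1 <= k < N.+1) freq R k ^+ (2 * j) *
    (ac t k * dtcoefc nu u t k + bs t k * dtcoefs nu u t k)).
Proof.
move=> t0; rewrite (_ : (fun s => _) = 2^-1 *: \sum_(k < N)
   (fun s => freq R k.+1 ^+ (2 * j) * (ac s k.+1 ^+ 2 + bs s k.+1 ^+ 2))); last first.
  apply/funext => s; rewrite /energy big_add1 big_mkord.
  by rewrite /GRing.scale/= fct_sumE.
rewrite big_add1 big_mkord.
have h : is_derive t 1 (\sum_(k < N)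
   (fun s => freq R k.+1 ^+ (2 * j) * (ac s k.+1 ^+ 2 + bs s k.+1 ^+ 2)))
   (\sum_(k < N) (freq R k.+1 ^+ (2 * j) *
   (2 * (ac t k.+1 * dtcoefc nu u t k.+1) + 2 * (bs t k.+1 * dtcoefs nu u t k.+1)))); last first.
  apply: (is_derive_eq (is_deriveZ 2^-1 h)).
  by rewrite /GRing.scale/= mulr_sumr; apply: eq_bigr => k _; field.
apply: is_derive_sum => k.
have [d1 d2] := is_derive_sol_coef sol t0 (ltn_ord k).
exact: (is_derive_weighted_sqr _ d1 d2).
Qed.

(** Transport conserves the L^2 norm: [u (u u_x)] is the derivative of [u ^ 3 / 3]. The zero mode
    must vanish separately for the sum to start at 1, and it does since [u u_x] is the derivative of
    [u ^ 2 / 2]. *)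
Lemma sum_coef_nonlinearity (t : R) : 0 <= t ->
  \sum_(1 <= k < N.+1) (ac t k * coefc (g t) k + bs t k * coefs (g t) k) = 0.
Proof.
move=> t0.
have d1 (x : R) := is_derive_trigpoly N (ac t) (bs t) x.
have cu := continuous_trigpoly (n := N) (a := ac t) (b := bs t).
have g0 : coefc (g t) 0 = 0.
  rewrite /coefc /weight/= mul1r.
  apply: (@mean_derive_periodic _ (fun x => 2^-1 * utrig t x ^+ 2)).
  - move=> x; apply: (is_derive_eq (is_deriveZ 2^-1 (is_deriveX 2 (d1 x)))).
    by rewrite cosk0 mulr1 sol_gE// /GRing.scale/= expr1; field.
  - apply: continuousMr; last exact: continuous_cosk.
    exact: continuous_sol_g.
  - by move=> x; rewrite trigpoly_periodic.
have z : mean (fun x => g t x * utrig t x) = 0.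
  apply: (@mean_derive_periodic _ (fun x => 3^-1 * utrig t x ^+ 3)).
  - move=> x; apply: (is_derive_eq (is_deriveZ 3^-1 (is_deriveX 3 (d1 x)))).
    by rewrite sol_gE// /GRing.scale/=; field.
  - by apply: continuousMr => //; exact: continuous_sol_g.
  - by move=> x; rewrite trigpoly_periodic.
move: z; rewrite mean_mul_trigpoly; last exact/continuous_integrable_coefs/continuous_sol_g.
rewrite (sum_weight N (fun k => ac t k * coefc (g t) k + bs t k * coefs (g t) k)) g0 mulr0 add0r.
have -> : coefs (g t) 0 = 0.
  rewrite /coefs (eq_mean (g := fun=> 0)) ?mean_cst ?mulr0// => x.
  by rewrite sink0 mulr0.
rewrite mulr0 add0r => /eqP; rewrite mulf_eq0 invr_eq0 => /orP[|/eqP//].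
by rewrite pnatr_eq0.
Qed.

(** The factor [- freq k ^ 2] turns the coefficients of [u] into those of [u_xx]; this cubic mean is
    the one bounded in [cubic_estimate]. *)
Lemma sum_freq_coef_nonlinearity (t : R) : 0 <= t ->
  \sum_(1 <= k < N.+1) freq R k ^+ 2 * (ac t k * coefc (g t) k + bs t k * coefs (g t) k) =
  - 2 * mean (fun x => utrig t x * uxtrig t x * uxxtrig t x).
Proof.
move=> t0; rewrite (eq_mean (g := fun x => g t x * uxxtrig t x)); last first.
  by move=> x; rewrite -(sol_gE x t0).
rewrite mean_mul_trigpoly; last first.
  exact/continuous_integrable_coefs/continuous_sol_g.
rewrite (sum_weight N (fun k => ddcoefc (ac t) k * coefc (g t) k + ddcoefs (bs t) k * coefs (g t) k)).
rewrite /ddcoefc /ddcoefs freq0 oppr0 !mul0r !add0r mulrA mulNr divff// mulN1r -sumrN.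
by apply: eq_bigr => k _; ring.
Qed.

Lemma is_derive_energy0 (t : R) : 0 < t ->
  is_derive t 1 (fun s => E 0 s) (- 2 * nu ^+ 2 * E 1 t).
Proof.
move=> t0; apply: (is_derive_eq (is_derive_energy 0 t0)).
transitivity (- \sum_(1 <= k < N.+1) (ac t k * coefc (g t) k + bs t k * coefs (g t) k) +
   - nu ^+ 2 * \sum_(1 <= k < N.+1) freq R k ^+ 2 * (ac t k ^+ 2 + bs t k ^+ 2)).
  rewrite -sumrN mulr_sumr -big_split/=; apply: eq_bigr => k _.
  by rewrite muln0 expr0 /dtcoefc /dtcoefs; ring.
by rewrite sum_coef_nonlinearity ?(ltW t0)// /energy muln1; field.
Qed.

Lemma is_derive_energy1 (t : R) : 0 < t ->
  is_derive t 1 (fun s => E 1 s) (- 2 * nu ^+ 2 * E 2 t +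
    2 * mean (fun x => utrig t x * uxtrig t x * uxxtrig t x)).
Proof.
move=> t0; apply: (is_derive_eq (is_derive_energy 1 t0)).
have := sum_freq_coef_nonlinearity (ltW t0) => e.
transitivity (- \sum_(1 <= k < N.+1) freq R k ^+ 2 *
    (ac t k * coefc (g t) k + bs t k * coefs (g t) k) +
   - nu ^+ 2 * \sum_(1 <= k < N.+1) freq R k ^+ 4 * (ac t k ^+ 2 + bs t k ^+ 2)).
  rewrite -sumrN mulr_sumr -big_split/=; apply: eq_bigr => k _.
  by rewrite muln1 /dtcoefc /dtcoefs; ring.
by rewrite e /energy (_ : (2 * 2)%N = 4%N)//; field.
Qed.

Lemma within_continuous_energy j :
  {within [set t : R | 0 <= t], continuous (fun s => E j s)}.
Proof.
apply/within_continuousP => t t0; rewrite /energy.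
apply: cvgM; first exact: cvg_cst.
apply: cvg_big => [|k _]; first exact: add_continuous.
have [/within_continuousP c1 /within_continuousP c2] := continuous_sol_coef sol k.
apply: cvgM; first exact: cvg_cst.
have {}c1 := c1 t t0; have {}c2 := c2 t t0.
by apply: cvgD; [exact: (cvgM c1 c1)|exact: (cvgM c2 c2)].
Qed.

Lemma energy0_init : E 0 0 <= M ^+ 2.
Proof.
apply: le_trans (bessel N fL fM).
rewrite (sol_initial sol); apply: (@le_trans _ _ (2^-1 * \sum_(1 <= k < N.+1)
  (coefc f k ^+ 2 + coefs f k ^+ 2))); last by rewrite lerDr sqr_ge0.
rewrite /energy le_eqVlt; apply/orP; left; apply/eqP; congr (_ * _).
apply: eq_big_nat => k /andP[_ kN]; rewrite muln0 expr0 mul1r.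
by have [-> ->] := coef_fourier_proj f (kN : (k <= N)%N).
Qed.

Lemma energy0_le (t : R) : 0 <= t -> E 0 t <= M ^+ 2.
Proof.
move=> t0; apply: le_trans energy0_init.
apply: (@ler0_derive1_le_cc _ (fun s => E 0 s) 0 t) => //.
- move=> s; rewrite in_itv/= => /andP[s0 _].
  by have [] := is_derive_energy0 s0.
- move=> s; rewrite in_itv/= => /andP[s0 _]; rewrite derive1E.
  have [_ ->] := is_derive_energy0 s0.
  by rewrite 2!mulNr oppr_le0 mulr_ge0 ?energy_ge0// mulr_ge0 ?sqr_ge0.
- apply: continuous_subspaceW (@within_continuous_energy 0).
  by move=> s /=; rewrite in_itv/= => /andP[].
- by rewrite in_itv/= lexx t0.
- by rewrite in_itv/= lexx t0.
Qed.

Lemma energy1_init : E 1 0 <= (2 * pi * N%:R) ^+ 2 * M ^+ 2.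
Proof.
apply: le_trans (_ : (2 * pi * N%:R) ^+ 2 * E 0 0 <= _); last first.
  by rewrite ler_wpM2l ?sqr_ge0// energy0_init.
rewrite /energy mulrCA ler_pM2l// mulr_sumr; apply: ler_sum_nat => k /andP[_ kN].
rewrite muln0 muln1 expr0 mul1r ler_wpM2r ?addr_ge0 ?sqr_ge0//.
rewrite ler_sqr ?nnegrE ?freq_ge0 ?mulr_ge0 ?pi_ge0//.
by rewrite /freq ler_wpM2l ?mulr_ge0 ?pi_ge0// ler_nat.
Qed.

Local Notation K := (cubic_const nu M).

Lemma cubic_const_ge0 : 0 <= K.
Proof.
rewrite /cubic_const; apply: divr_ge0; first by apply: mulr_ge0 => //; exact: sqr_ge0.
exact/exprn_ge0/ltW.
Qed.

Local Notation kappa := (K / nu ^+ 2).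
(** Chosen so that the decay [2 nu ^ 2 C2 E_1] of [C2 E_0] equals
    [(2 + 2 / nu ^ 2) (1 + kappa) E_1], which dominates what the growth of the weight leaves
    over. *)
Definition lyapunov_const : R := (2 + 2 / nu ^+ 2) * (1 + kappa) / (2 * nu ^+ 2).
Local Notation C2 := lyapunov_const.
(* [N ^ -2] makes [time_shift |u_x(0)|_2 ^ 2] bounded; the factor [t + 1] makes the
   inverse of [time_weight] integrable at infinity. *)
Definition time_shift : R := (N%:R ^+ 2)^-1.
Definition time_weight (t : R) : R := (t + time_shift) * (t + 1).
(* The [kappa] term absorbs the cubic growth of [E 1], the [C2] term the
   derivative of the weight. *)
Definition lyapunov (t : R) : R := time_weight t * (E 1 t + kappa * E 0 t) + C2 * E 0 t.

Lemma time_shift_gt0 : 0 < time_shift. Proof. by rewrite invr_gt0 exprn_gt0// ltr0n. Qed.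
Lemma time_shift_le1 : time_shift <= 1.
Proof. by rewrite invf_le1 ?exprn_gt0 ?ltr0n// exprn_ege1// ler1n. Qed.

Lemma kappa_ge0 : 0 <= kappa.
Proof. by apply: divr_ge0; [exact: cubic_const_ge0|exact: sqr_ge0]. Qed.

Lemma lyapunov_const_ge0 : 0 <= C2.
Proof.
have p : 0 < nu ^+ 2 by rewrite exprn_gt0.
have h : 0 <= 2 / nu ^+ 2 by rewrite divr_ge0// ltW.
have k0 := kappa_ge0; apply: divr_ge0; last by apply: mulr_ge0 => //; exact: ltW.
by apply: mulr_ge0; apply: addr_ge0.
Qed.

Lemma is_derive_time_weight (t : R) : is_derive t 1 time_weight (2 * t + 1 + time_shift).
Proof.
have h1 (c : R) : is_derive t 1 (fun s => s + c) 1.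
  by apply: (is_derive_eq (is_deriveD (is_derive_id t 1) (is_derive_cst c t 1)));
    rewrite addr0.
apply: (is_derive_eq (is_deriveM (h1 time_shift) (h1 1))).
by rewrite /GRing.scale/=; ring.
Qed.

Lemma lyapunov_ge0 (t : R) : 0 <= t -> 0 <= lyapunov t.
Proof.
move=> t0; have tau0 := time_shift_gt0.
have e0 := energy_ge0 0 N (ac t) (bs t); have e1 := energy_ge0 1 N (ac t) (bs t).
rewrite /lyapunov; apply: addr_ge0; last exact: mulr_ge0 lyapunov_const_ge0 e0.
apply: mulr_ge0; first by apply: mulr_ge0; lra.
exact: addr_ge0 e1 (mulr_ge0 kappa_ge0 e0).
Qed.

(** At time 0 the weight is [N^-2] and cancels the [N ^ 2] of [energy1_init], so the bound does not
    depend on [N]. *)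
Lemma lyapunov_init : lyapunov 0 <= (4 * pi ^+ 2 + kappa + C2) * M ^+ 2.
Proof.
have e0 := energy0_init; have e1 := energy1_init.
have e00 := energy_ge0 0 N (ac 0) (bs 0).
rewrite /lyapunov /time_weight add0r add0r mulr1 mulrDr 2!mulrDl; apply: lerD; last first.
  by rewrite ler_wpM2l ?lyapunov_const_ge0.
apply: lerD.
  apply: (le_trans (ler_wpM2l (ltW time_shift_gt0) e1)).
  rewrite le_eqVlt; apply/orP; left; apply/eqP; rewrite /time_shift; field.
  by rewrite pnatr_eq0 -lt0n.
apply: (@le_trans _ _ (1 * (kappa * E 0 0))).
  by rewrite ler_wpM2r ?time_shift_le1// mulr_ge0// kappa_ge0.
by rewrite mul1r ler_wpM2l// kappa_ge0.
Qed.

(** The decrease of [lyapunov] pays for the weighted dissipation. The derivative stays existential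
    since only this inequality about it is used. *)
Lemma derive_lyapunov (t : R) : 0 < t -> exists2 d, is_derive t 1 lyapunov d &
  2^-1 * nu ^+ 2 * (time_weight t * E 2 t) <= - d.
Proof.
move=> t0; have d0 := is_derive_energy0 t0; have d1 := is_derive_energy1 t0.
set cub := mean _ in d1.
have cubP : 2 * cub <= nu ^+ 2 * E 2 t + K * E 1 t.
  by apply: cubic_estimate => //; exact/energy0_le/ltW.
pose F (s : R) := E 1 s + kappa * E 0 s.
have dF := is_deriveD d1 (is_deriveZ kappa d0).
have dG := is_deriveD (is_deriveM (is_derive_time_weight t) dF) (is_deriveZ C2 d0).
eexists; first exact: dG.
rewrite /GRing.scale/= -/(F t) -[(_ + _ *: _) t]/(F t).
have e00 := energy_ge0 0 N (ac t) (bs t).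
have e01 : E 0 t <= E 1 t := energy_le 0 _ _ _.
have e12 : E 1 t <= E 2 t := energy_le 1 _ _ _.
have tau0 := time_shift_gt0; have tau1 := time_shift_le1.
have p : 0 < nu ^+ 2 by rewrite exprn_gt0.
have w0 : 0 < time_weight t by apply: mulr_gt0; lra.
have k0 := kappa_ge0.
have F0 : 0 <= F t by exact: addr_ge0 (energy_ge0 1 _ _ _) (mulr_ge0 k0 e00).
(* The cubic bound gives [- nu ^ 2 E_2 + K E_1], and [kappa E_0] contributes [- 2 K E_1]. Half of
   the [E_2] term is kept; the other half and the remaining [- K E_1] become, by Poincare's
   inequality, decay of [F] at rate [nu ^ 2 / 2]. *)
have Fd : - 2 * nu ^+ 2 * E 2 t + 2 * cub + kappa * (- 2 * nu ^+ 2 * E 1 t) <=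
    - (2^-1 * nu ^+ 2 * E 2 t) - 2^-1 * nu ^+ 2 * F t.
  have -> : kappa * (- 2 * nu ^+ 2 * E 1 t) = - 2 * (K * E 1 t) by field; rewrite gt_eqF.
  have -> : 2^-1 * nu ^+ 2 * F t = 2^-1 * (nu ^+ 2 * E 1 t) + 2^-1 * (K * E 0 t).
    by rewrite /F; field; rewrite gt_eqF.
  have h1 : nu ^+ 2 * E 1 t <= nu ^+ 2 * E 2 t by rewrite ler_pM2l.
  have h2 : K * E 0 t <= K * E 1 t by rewrite ler_wpM2l// cubic_const_ge0.
  have h3 : 0 <= K * E 0 t by rewrite mulr_ge0// cubic_const_ge0.
  move: cubP h1 h2 h3; rewrite -!mulrA.
  set X2 := nu ^+ 2 * E 2 t; set X1 := nu ^+ 2 * E 1 t; set Y1 := K * E 1 t; set Y0 := K * E 0 t.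
  lra.
have h1 := ler_wpM2l (ltW w0) Fd.
(* The decay of [F] outweighs the growth of the weight for large [t]: the excess is at most
   [2 t + 2 - nu ^ 2 t ^ 2 / 2], whose maximum, at [t = 2 / nu ^ 2], is [2 + 2 / nu ^ 2]. *)
have h2 : (2 * t + 1 + time_shift - 2^-1 * nu ^+ 2 * time_weight t) * F t <= (2 + 2 / nu ^+ 2) * F t.
  apply: ler_wpM2r => //; rewrite /time_weight.
  apply: (@le_trans _ _ (2 * t + 2 - 2^-1 * nu ^+ 2 * t ^+ 2)).
    have : 2^-1 * nu ^+ 2 * t ^+ 2 <= 2^-1 * nu ^+ 2 * ((t + time_shift) * (t + 1)).
      rewrite ler_pM2l ?mulr_gt0// expr2; apply: ler_pM => //; lra.
    lra.
  rewrite -subr_ge0 (_ : _ - _ = (2 / nu ^+ 2) * (1 - 2^-1 * nu ^+ 2 * t) ^+ 2).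
    by rewrite mulr_ge0 ?sqr_ge0// divr_ge0// ltW.
  by field; rewrite gt_eqF.
have h3 : F t <= (1 + kappa) * E 1 t.
  by rewrite /F mulrDl mul1r lerD2l ler_wpM2l.
have h4 : (2 + 2 / nu ^+ 2) * F t <= C2 * (2 * nu ^+ 2 * E 1 t).
  have -> : C2 * (2 * nu ^+ 2 * E 1 t) = (2 + 2 / nu ^+ 2) * ((1 + kappa) * E 1 t).
    by rewrite /C2; field; rewrite gt_eqF.
  rewrite ler_wpM2l// addr_ge0// divr_ge0// ltW//.
move: h1 h2 h4; set X := _ + _ + kappa * _; set Y := C2 * _.
have -> : C2 * (- 2 * nu ^+ 2 * E 1 t) = - Y by rewrite /Y; ring.
rewrite mulrBr mulrN mulrBl.
set Z := E 2 t; set W := time_weight t; set V := F t => h1 h2 h4.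
have e1 : W * (2^-1 * nu ^+ 2 * Z) = 2^-1 * nu ^+ 2 * (W * Z) by ring.
have e2 : W * (2^-1 * nu ^+ 2 * V) = 2^-1 * nu ^+ 2 * W * V by ring.
rewrite e1 e2 in h1.
rewrite (mulrC V).
lra.
Qed.

End energy_evolution.

(** * The supremum bound *)

Section sup_bound.
Variable R : realType.
Variables (nu : R) (N : nat) (f : R -> R) (M : R) (u : R -> R -> R).
Hypotheses (nu_gt0 : 0 < nu) (N_gt1 : (1 < N)%N).
Hypotheses (fL : Linfty_torus f) (fM : Linfty_norm f = M%:E).
Hypothesis sol : galerkin_solution nu N (fourier_proj N f) u.

Let N_gt0 : (0 < N)%N. Proof. exact: ltnW. Qed.
Let NR_gt0 : 0 < N%:R :> R. Proof. by rewrite ltr0n. Qed.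
(** From [2 <= N] the shift is at most 1/4; hence [1 / w] is below twice [(1 - time_shift) / w], the
    derivative of the logarithmic part of the barrier. *)
Let time_shift_lt : time_shift R N < 2^-1.
Proof.
rewrite /time_shift ltf_pV2 ?posrE ?exprn_gt0// -natrX ltr_nat.
by apply: (@leq_trans (2 ^ 2)) => //; rewrite leq_exp2r.
Qed.

(** The barrier is [A exp Lam], where the derivative of [Lam] exceeds the projection error divided
    by [|u(t)|_oo] wherever the solution reaches the barrier. Since [x ^ 12 = N], the factor
    [x ^- 6] is [N^(-1/2)]. *)
Lemma sol_sup_le (A x t y : R) : 0 < A -> 0 < x -> x ^+ 12 = N%:R ->
  (forall z, `|fourier_proj N f z| <= A) -> 0 <= t ->
  `|u t y| <= A * expR (40 * x ^- 6 * (ln (N%:R ^+ 2) +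
    (4 * pi ^+ 2 + cubic_const nu M / nu ^+ 2 + lyapunov_const nu M) * M ^+ 2 / nu ^+ 2)).
Proof.
move=> A0 x0 xN fA t0.
have t_gt0 := time_shift_gt0 R N_gt0; have tau1 := time_shift_le1 R N_gt0.
set L := lyapunov nu N M u.
(* Here [40 = 2 * 20]: the 20 is that of [projection_error], and the 2 covers the losses in [k1] and
   [k2] below. *)
pose c := 40 * x ^- 6; have c0 : 0 < c by rewrite mulr_gt0// invr_gt0 exprn_gt0.
pose Lam (s : R) := c * (ln (s + time_shift R N) - ln (s + 1) - ln (time_shift R N) + (L 0 - L s) / nu ^+ 2).
have p : 0 < nu ^+ 2 by rewrite exprn_gt0.
apply: (@le_trans _ _ (A * expR (Lam t))); last first.
  rewrite ler_pM2l// ler_expR ler_pM2l//; apply: lerD.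
    have : ln (t + time_shift R N) <= ln (t + 1) by rewrite ler_ln ?posrE; lra.
    have -> : ln (time_shift R N) = - ln (N%:R ^+ 2) by rewrite lnV ?posrE ?exprn_gt0.
    lra.
  rewrite ler_pM2r ?invr_gt0//.
  have := lyapunov_init nu_gt0 N_gt0 fL fM sol; rewrite -/L.
  have := @lyapunov_ge0 R nu N M u nu_gt0 N_gt0 t t0; rewrite -/L; lra.
have dln (s r : R) : 0 < s + r -> is_derive s 1 (fun z => ln (z + r)) (s + r)^-1.
  move=> sr.
  have h : is_derive s 1 (fun z => z + r) 1.
    by apply: (is_derive_eq (is_deriveD (is_derive_id s 1) (is_derive_cst r s 1)));
      rewrite addr0.
  apply: (is_derive_eq (is_derive1_comp (g := fun z => z + r) (is_derive1_ln sr) h)).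
  by rewrite mulr1.
have dLam (s : R) : 0 < s -> exists2 d, is_derive s 1 Lam d &
    20 * x ^- 6 * ((time_weight N s)^-1 + time_weight N s * energy 2 N (coefc (u s)) (coefs (u s))) < d.
  move=> s0; have [d dL dLd] := derive_lyapunov nu_gt0 N_gt0 fL fM sol s0.
  have h1 := dln s (time_shift R N) (ltr_wpDr (ltW t_gt0) s0).
  have h2 := dln s 1 (ltr_wpDr ler01 s0).
  have h3 := is_deriveB (is_deriveB h1 h2) (is_derive_cst (ln (time_shift R N)) s 1).
  have h4 := is_deriveM (is_deriveB (is_derive_cst (L 0) s 1) dL)
     (is_derive_cst (nu ^+ 2)^-1 s 1).
  exists (c * ((s + time_shift R N)^-1 - (s + 1)^-1 - d / nu ^+ 2)).
    apply: (is_derive_eq (is_deriveZ c (is_deriveD h3 h4))).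
    by rewrite /GRing.scale/=; ring.
  have w0 : 0 < time_weight N s by apply: mulr_gt0; lra.
  have -> : (s + time_shift R N)^-1 - (s + 1)^-1 = (1 - time_shift R N) / time_weight N s.
    by rewrite /time_weight; field; rewrite !gt_eqF//; lra.
  rewrite /c (_ : 40 * x ^- 6 = 20 * x ^- 6 * 2); last by ring.
  rewrite -[ltRHS]mulrA ltr_pM2l; last by rewrite mulr_gt0// invr_gt0 exprn_gt0.
  have k1 : (time_weight N s)^-1 < 2 * ((1 - time_shift R N) / time_weight N s).
    rewrite -[ltLHS]mul1r mulrA ltr_pM2r ?invr_gt0//.
    by move: time_shift_lt; set T := time_shift R N => ?; lra.
  have k2 : time_weight N s * energy 2 N (coefc (u s)) (coefs (u s)) <= 2 * (- d / nu ^+ 2).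
    by rewrite mulrA ler_pdivlMr// mulrC; lra.
  rewrite mulrBr; move: k1 k2; rewrite mulNr; set X := 2 * _; lra.
have dPhi (s d : R) : is_derive s 1 Lam d ->
    is_derive s 1 (fun s => A * expR (Lam s)) (d * (A * expR (Lam s))).
  move=> dl; apply: (is_derive_eq (is_deriveZ A (is_derive1_comp (is_derive_expR _) dl))).
  by rewrite /GRing.scale/=; ring.
apply: (@parabolic_comparison R u (fun s => A * expR (Lam s)) _ _ _ _ _ _ _ _ t y t0).
- exact: (sol_periodic sol).
- exact: (sol_continuous sol).
- apply/within_continuousP => s s0; apply: cvgM; first exact: cvg_cst.
  apply: (@cvg_comp _ _ _ Lam expR _ (nbhs (Lam s))); last exact: continuous_expR.
  apply: cvgM; first exact: cvg_cst.
  have lnc r : 0 < s + r -> ln (z + r) @[z --> within [set t : R | 0 <= t] (nbhs s)] --> ln (s + r).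
    move=> sr; apply: cvg_within_filter; have [h _] := dln s r sr.
    by have /derivable1_diffP/differentiable_continuous := h.
  have cE j := (within_continuousP _ _).1 (within_continuous_energy sol (j := j)) s s0.
  apply: cvgD.
    apply: cvgB; last exact: cvg_cst.
    by apply: cvgB; apply: lnc; move: s0 => /=; lra.
  apply: cvgM; last exact: cvg_cst.
  apply: cvgB; first exact: cvg_cst.
  have cw : time_weight N z @[z --> within [set t : R | 0 <= t] (nbhs s)] --> time_weight N s.
    apply: cvg_within_filter.
    exact: (is_derive_continuous (@is_derive_time_weight R N)).

  apply: cvgD; last by apply: cvgM; [exact: cvg_cst|exact: cE].
  apply: cvgM => //; apply: cvgD; first exact: cE.
  by apply: cvgM; [exact: cvg_cst|exact: cE].
- by move=> s _; rewrite mulr_gt0// expR_gt0.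
- exact: (sol_derivable_t sol).
- by move=> s s0; have [d /dPhi[]] := dLam s s0.
- move=> z; rewrite (sol_initial sol); apply: (le_trans (fA z)).
  have -> : Lam 0 = 0 by rewrite /Lam !add0r ln1; ring.
  by rewrite expR0 mulr1.
move=> s z s0 zmax; pose Phi := A * expR (Lam s).
have Phi0 : 0 < Phi by rewrite mulr_gt0// expR_gt0.
have [d /dPhi[_ dE] dlt] := dLam s s0.
have {}dE : derive1 (fun s => A * expR (Lam s)) s = d * Phi by rewrite derive1E.
rewrite dE; change (Phi <= `|u s z| ->
  Num.sg (u s z) * derive1 (u ^~ z) s * Phi < `|u s z| * (d * Phi)) => Phiz.
rewrite [ltRHS]mulrA ltr_pM2r//.
set m := `|u s z| in zmax Phiz *.
have m0 : 0 < m by exact: lt_le_trans Phiz.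
have w0 : 0 < time_weight N s by apply: mulr_gt0; lra.
(* Balances the two terms of [projection_error]. *)
pose th := x ^- 6 * time_weight N s / m.
have x6 : 0 < x ^+ 6 by rewrite exprn_gt0.
have th0 : 0 < th by rewrite divr_gt0// mulr_gt0// invr_gt0.
set E2 := energy 2 _ _ _ in dlt.
pose g r := u s r * derive1 (u s) r.
(* Both terms acquire the factor [x ^- 6 m]; the one with [1 / w] is enlarged by 20 so that they
   share a prefactor. *)
have err : `|g z - fourier_proj N g z| <= 20 * x ^- 6 * ((time_weight N s)^-1 + time_weight N s * E2) * m.
  have uE := sol_trigpoly nu_gt0 sol (ltW s0).
  have := @projection_error R N (coefc (u s)) (coefs (u s)) m th g z N_gt0 th0.
  rewrite -uE => /(_ zmax) /(_ _)/wrap[].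
    by move=> r; rewrite -(sol_x_trigpoly nu_gt0 sol (ltW s0)).
  rewrite fourier_proj_trigpoly => /le_trans; apply.
  have e1 : 20 * th * m ^+ 2 * E2 = 20 * x ^- 6 * (time_weight N s * E2) * m.
    by rewrite /th; field; rewrite !gt_eqF.
  have e2 : (th * N%:R)^-1 = x ^- 6 * (time_weight N s)^-1 * m.
    by rewrite /th -xN; field; rewrite !gt_eqF.
  rewrite e1 -/E2 e2.
  have : 0 < x ^- 6 * (time_weight N s)^-1 * m by rewrite !mulr_gt0// invr_gt0.
  rewrite mulrDr mulrDl -!mulrA; lra.
have sgle r : Num.sg (u s z) * r <= `|r|.
  apply: (le_trans (ler_norm _)); rewrite normrM ler_piMl// normr_sg.
  by case: eqP.
have sgmax r : Num.sg (u s z) * u s r <= Num.sg (u s z) * u s z.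
  by rewrite -normrEsg; exact: le_trans (sgle _) (zmax r).
have d1 (r : R) := is_deriveZ (Num.sg (u s z)) (sol_is_derive_x sol r s0).
have d2 := is_deriveZ (Num.sg (u s z)) (sol_is_derive_xx sol z s0).
have ux0 := max_derive_eq0 (d1 z) sgmax.
have uxx0 := max_derive2_le0 d1 d2 sgmax.
have := sol_equation sol z s0; rewrite -/g => eqn.
have -> : derive1 (u ^~ z) s = (g z - fourier_proj N g z) - g z +
    nu ^+ 2 * derive1 (derive1 (u s)) z by rewrite -eqn; ring.
rewrite mulrDr mulrBr (mulrCA _ (nu ^+ 2)) /g (mulrCA _ (u s z)).
move: ux0 uxx0; rewrite /GRing.scale/= => -> uxx0; rewrite mulr0 subr0.
apply: (@le_lt_trans _ _ (20 * x ^- 6 * ((time_weight N s)^-1 + time_weight N s * E2) * m)).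
  apply: (@le_trans _ _ (`|g z - fourier_proj N g z| + 0)); last by rewrite addr0.
  by apply: lerD; [exact: sgle|rewrite pmulr_rle0].
by rewrite (mulrC m) ltr_pM2r.
Qed.

End sup_bound.

(** * Bookkeeping of the powers of [N] *)

Section final_bound.
Variable R : realType.
Implicit Types (nu M x : R).

Definition initial_const nu M : R :=
  (4 * pi ^+ 2 + cubic_const nu M / nu ^+ 2 + lyapunov_const nu M) * M ^+ 2 / nu ^+ 2.

Lemma initial_const_ge0 nu M : 0 < nu -> 0 <= initial_const nu M.
Proof.
move=> nu0; apply: divr_ge0; last exact: sqr_ge0.
apply: mulr_ge0; last exact: sqr_ge0.
apply: addr_ge0; last exact: lyapunov_const_ge0.
by apply: addr_ge0; [rewrite mulr_ge0// sqr_ge0|exact: kappa_ge0].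
Qed.

Definition growth_const nu M : R := 40 * (24 + initial_const nu M).

Lemma growth_const_gt0 nu M : 0 < nu -> 0 < growth_const nu M.
Proof. by move=> nu0; rewrite mulr_gt0// ltr_pwDl// initial_const_ge0. Qed.

(** The logarithm is [ln (x ^ 24) <= 24 x], which costs one of the six powers of [x]. *)
Lemma exponent_le nu M (N : nat) x : 0 < nu -> 1 <= x -> x ^+ 12 = N%:R ->
  40 * x ^- 6 * (ln (N%:R ^+ 2) + initial_const nu M) <= growth_const nu M * x ^- 5.
Proof.
move=> nu0 x1 xN; have x0 : 0 < x by lra.
have C0 := initial_const_ge0 M nu0; rewrite /growth_const.
set C := initial_const nu M in C0 *.
have lnN : ln (N%:R ^+ 2) <= 24 * x.
  rewrite -xN -exprM lnXn// -[leLHS]mulr_natl (_ : (12 * 2)%N = 24%N)//.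
  by rewrite ler_wpM2l//; exact/ltW/ln_sublinear.
rewrite -!mulrA ler_pM2l// [leRHS]mulrC.
rewrite (_ : x ^- 5 = x ^- 6 * x); last by field; rewrite gt_eqF.
rewrite -mulrA ler_pM2l ?invr_gt0 ?exprn_gt0//.
have : C <= x * C by rewrite ler_peMl.
by rewrite mulrDr; lra.
Qed.

(** With this root, [N^(1/3)], [N^(1/2)] and the final rate are integer powers of [x]: [x ^ 4],
    [x ^ 6] and [x^-1]. *)
Lemma twelfth_root (N : nat) : (0 < N)%N -> let x : R := N%:R `^ 12^-1 in
  [/\ 1 <= x, x ^+ 12 = N%:R & N%:R `^ (- 12^-1) = x^-1].
Proof.
move=> N0 x; have N1 : 1 <= N%:R :> R by rewrite ler1n.
split; last exact: powRN.
  by rewrite /x -[leLHS](powRr0 N%:R); apply: ler_powR.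
by rewrite /x -powR_mulrn ?powR_ge0// -powRrM mulVf ?powRr1.
Qed.

(* [n] is the scale at which the Dirichlet kernel is cut. *)
Lemma cube_approx (N : nat) x : 1 <= x -> x ^+ 12 = N%:R ->
  exists n : nat, [/\ (0 < n)%N, (N <= 8 * n ^ 3)%N & n%:R <= x ^+ 4].
Proof.
move=> x1 xN; have x0 : 0 <= x by exact: le_trans x1.
have x4 : 1 <= x ^+ 4 by rewrite exprn_ege1.
(* [n] is the integer part of [x ^ 4], so [x ^ 4 < n + 1 <= 2 n]; cubing gives the factor 8. *)
have /andP[h1 h2] := truncn_itv (le_trans ler01 x4).
set n := Num.truncn _ in h1 h2.
have n0 : (0 < n)%N.
  by rewrite lt0n; apply/eqP => nz; move: h2; rewrite nz; lra.
exists n; split => //.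
rewrite -(ler_nat R) natrM natrX -xN -[12%N]/(4 * 3)%N exprM.
apply: (@le_trans _ _ ((2 * n%:R) ^+ 3)); last by rewrite exprMn; lra.
apply: lerXn2r; rewrite ?nnegrE ?mulr_ge0 ?exprn_ge0//.
apply: (le_trans (ltW h2)); rewrite -natr1.
have : 1 <= n%:R :> R by rewrite ler1n.
lra.
Qed.

End final_bound.

Theorem theorem1p9 (R : realType) :
  exists2 c : R, 0 < c &
  exists2 alpha : R -> R -> R,
    (forall M nu : R, 0 <= M -> 0 < nu -> 0 < alpha M nu) &
    forall (nu : R) (f : R -> R) (M : R) (N : nat) (u : R -> R -> R),
      0 < nu -> Linfty_torus f -> Linfty_norm f = M%:E -> (2 <= N)%N ->
      galerkin_solution nu N (\Pi_(N) f) u ->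
      (ereal_sup [set Linfty_norm (u t) | t in [set t : R | (0 <= t)%R]] <=
       Linfty_norm (\Pi_(N) f) + (alpha M nu * N%:R `^ (- c))%:E)%E.
Proof.
exists 12^-1 => //.
pose X0 nu M : R := growth_const nu M.
(* The leading 1 pays for the slack [x^-1] added to the datum bound, [15 * M + 1] bounds the
   enlarged datum divided by [x ^ 4], and the last factor comes from [exp X - 1 <= X exp X]. *)
exists (fun M nu => 1 + (15 * M + 1) * (X0 nu M * expR (X0 nu M))).
  move=> M nu M0 nu0; have X00 := growth_const_gt0 M nu0.
  rewrite addr_gt0// mulr_gt0//; first by lra.
  by rewrite mulr_gt0// expR_gt0.
move=> nu f M N u nu0 fL fM N2 sol.
have N0 : (0 < N)%N by exact: ltnW.
have [x1 xN ->] := @twelfth_root R N N0; set x := _ `^ _ in x1 xN *.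
have x0 : 0 < x by lra.
have M0 : 0 <= M by rewrite -lee_fin -fM Lnorm_ge0.
have [n [n0 Nn nx]] := cube_approx x1 xN.
have fP z := fourier_proj_bound z fL fM n0 N0 Nn.
have [A0 A0E] : exists A0, Linfty_norm (\Pi_(N) f) = A0%:E.
  exists (fine (Linfty_norm (\Pi_(N) f))); rewrite fineK// ge0_fin_numE ?Lnorm_ge0//.
  by apply: le_lt_trans (Linfty_norm_le fP) _; rewrite ltry.
have A00 : 0 <= A0 by rewrite -lee_fin -A0E Lnorm_ge0.
have A0le : A0 <= 15 * M * x ^+ 4.
  rewrite -lee_fin -A0E; apply: (le_trans (Linfty_norm_le fP)); rewrite lee_fin.
  by rewrite mulrAC ler_wpM2l// mulr_ge0.
(* The slack [x^-1] makes the barrier positive even for a zero datum, and is of the size of the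
   final error. *)
have fA z : `|fourier_proj N f z| <= A0 + x^-1.
  apply: (@le_trans _ _ A0); last by rewrite lerDl invr_ge0 ltW.
  apply: Linfty_norm_ge; last by rewrite A0E.
    by move=> r; rewrite !fourier_proj_trigpoly trigpoly_periodic.
  exact: continuous_fourier_proj.
have Ap : 0 < A0 + x^-1 by rewrite ltr_wpDl// invr_gt0.
rewrite A0E -EFinD; apply: ge_ereal_sup => _ [t /= t0 <-].
apply: Linfty_norm_le => z.
apply: (le_trans (sol_sup_le nu0 N2 fL fM sol z Ap x0 xN fA t0)).
have := exponent_le M nu0 x1 xN; rewrite -/(X0 nu M); set X := _ * _ => XX0.
have X00 : 0 < X0 nu M := growth_const_gt0 M nu0.
have xi1 : x ^- 5 <= 1 by rewrite invf_le1 ?exprn_gt0// exprn_ege1.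
have xi0 : 0 < x ^- 5 by rewrite invr_gt0 exprn_gt0.
(* From [exp (- X) >= 1 - X]. The multiplicative growth thus becomes an additive error: [x ^- 5]
   absorbs the [x ^ 4] of the datum and leaves [x^-1]. *)
have eX : expR X <= 1 + X0 nu M * expR (X0 nu M) * x ^- 5.
  have h1 : expR X * (1 - X) <= 1.
    have := expR_ge1Dx (- X); rewrite expRN => h.
    by rewrite -ler_pdivlMl ?expR_gt0// mulr1.
  have h2 : expR X <= expR (X0 nu M).
    by rewrite ler_expR; apply: (le_trans XX0); rewrite ler_piMr// ltW.
  have h3 : X * expR X <= X0 nu M * x ^- 5 * expR (X0 nu M).
    apply: (@le_trans _ _ (X0 nu M * x ^- 5 * expR X)).
      by rewrite ler_pM2r ?expR_gt0.
    by rewrite ler_pM2l// mulr_gt0.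
  by move: h1 h3; rewrite [X0 nu M * x ^- 5 * _]mulrAC; lra.
apply: (le_trans (ler_wpM2l (ltW Ap) eX)).
set Y := X0 nu M * expR _ in eX *; have Y0 : 0 < Y by rewrite mulr_gt0 ?expR_gt0.
rewrite [leLHS](_ : _ = A0 + x^-1 + Y * ((A0 + x^-1) * x ^- 5)); last by ring.
rewrite [leRHS](_ : _ = A0 + x^-1 + Y * ((15 * M + 1) * x^-1)); last by ring.
rewrite lerD2l ler_pM2l// (_ : x ^- 5 = x ^- 4 * x^-1); last first.
  by field; rewrite gt_eqF.
rewrite mulrA ler_pM2r ?invr_gt0// ler_pdivrMr ?exprn_gt0// mulrDl mul1r.
apply: lerD => //; apply: (@le_trans _ _ 1); first by rewrite invf_le1.
by rewrite exprn_ege1.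
Qed.
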